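(* Let $f \in \mathbb{Z}[X,Y,Z] \setminus \{0\}$ be an irreducible, homogeneous polynomial of degree $n \ge 1$ such that the function field $K = \mathbb{Q}(C_f)$ over $\mathbb{Q}$ of the plane projective curve $C_f$ defined by $f=0$ is isomorphic to the rational function field $\mathbb{Q}(T)$. Then there exist $m \in \mathbb{N}$ and integer-valued polynomials $g_1, g_2, g_3 \in \mathrm{Int}(\mathbb{Z}^m)$ such that \[ \mathcal{L}_f \setminus \mathcal{L}_f^{\mathrm{bad}} = \bigl\{ \bigl( g_1(\underline{x}), g_2(\underline{x}), g_3(\underline{x}) \bigr) \ \big|\ \underline{x} \in \mathbb{Z}^m \bigr\}. \]
   Context: For $m\in\mathbb{N}$, $\mathrm{Int}(\mathbb{Z}^m) = \{ \varphi \in \mathbb{Q}[X_1, \dots, X_m] \mid \varphi(\mathbb{Z}^m) \subset \mathbb{Z} \}$ is the ring of integer-valued polynomials in $m$ variables. Let $\overline{\mathbb{Q}}$ be an algebraic closure of $\mathbb{Q}$ and $C_f = \{ (x:y:z) \in \mathbb{P}^2(\overline{\mathbb{Q}}) \mid f(x,y,z)=0 \}$. Let $K=\mathbb{Q}(C_f)$ be the function field of $C_f$ over $\mathbb{Q}$. For a point $(x:y:z)\in C_f$, let $R_{(x:y:z)} \subset K$ be the local ring of all rational functions in $K$ that are defined at $(x:y:z)$, with maximal ideal $\mathfrak{m}_{(x:y:z)}$. The point $(x:y:z)$ is singular if and only if $R_{(x:y:z)}$ is not a discrete valuation ring. A discrete valuation ring $\mathcal{O}_P \subset K$ (of the field $K$),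 with maximal ideal $P$, is said to lie above $R_{(x:y:z)}$ if $R_{(x:y:z)} \subset \mathcal{O}_P$ and $\mathfrak{m}_{(x:y:z)} \subset P$. $C_f^{\mathrm{bad}}$ denotes the set of those singular points $(x:y:z) \in C_f$ for which there exists no discrete valuation ring $\mathcal{O}_P$ above $R_{(x:y:z)}$ with $\mathcal{O}_P/P \simeq \mathbb{Q}$. The sets of integer solutions are \[ \mathcal{L}_f = \{ (x,y,z) \in \mathbb{Z}^3 \mid f(x,y,z) = 0 \}, \qquad \mathcal{L}_f^{\mathrm{bad}} = \{ (x,y,z) \in \mathcal{L}_f \mid (x:y:z) \in C_f^{\mathrm{bad}} \}. \] The trivial solution $(0,0,0)\in\mathcal{L}_f$ does not define a projective point, so it does not belong to $\mathcal{L}_f^{\mathrm{bad}}$. *)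

(* Defs.v *)
From HB Require Import structures.
From mathcomp Require Import all_boot all_order all_algebra all_field.
From mathcomp Require Import ring_quotient fraction mpoly.
From mathcomp.classical Require Import boolp.

Set Implicit Arguments.
Unset Strict Implicit.
Unset Printing Implicit Defensive.

Import Order.TTheory GRing.Theory Num.Theory.
Local Open Scope ring_scope.

Definition divides (R : comNzRingType) (a b : R) : Prop := exists c, b = c * a.

Definition irreducible_elt (R : idomainType) (a : R) : Prop :=
  [/\ a != 0, a \isn't a GRing.unit &
      forall b c, a = b * c -> (b \is a GRing.unit) || (c \is a GRing.unit)].

Definition prime_elt (R : idomainType) (a : R) : Prop :=
  [/\ a != 0, a \isn't a GRing.unit &
      forall b c, divides a (b * c) -> divides a b \/ divides a c].

Definition factorial_ring (R : idomainType) : Prop :=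
  forall a : R, a != 0 ->
  exists u (ps : seq R), [/\ u \is a GRing.unit,
    (forall p, p \in ps -> prime_elt p) & a = u * \prod_(p <- ps) p].

(* The following lemmas, up to [map_Q_prime], are Gauss's lemma: a nonconstant
   irreducible element of Z[X_1, ..., X_n] is prime in Q[X_1, ..., X_n].  It is
   what makes the homogeneous coordinate ring of a plane curve a domain. *)
Lemma prime_irreducible (R : idomainType) (p : R) :
  prime_elt p -> irreducible_elt p.
Proof.
case=> p0 pU pP; split=> // b c e.
have b0 : b != 0 by apply: contraNneq p0 => b0; rewrite e b0 mul0r.
have c0 : c != 0 by apply: contraNneq p0 => c0; rewrite e c0 mulr0.
have /pP[[d bE]|[d cE]] : divides p (b * c) by exists 1; rewrite mul1r.
  apply/orP; right; apply/unitrP; exists d.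
  suff dc : d * c = 1 by split; rewrite // mulrC.
  by apply: (mulfI b0); rewrite mulr1 mulrCA -e -bE.
apply/orP; left; apply/unitrP; exists d.
suff dc : d * b = 1 by split; rewrite // mulrC.
by apply: (mulIf c0); rewrite mul1r -mulrA -e -cE.
Qed.

Lemma prime_prod (R : idomainType) (p : R) (ps : seq R) : prime_elt p ->
  divides p (\prod_(q <- ps) q) -> exists2 q, q \in ps & divides p q.
Proof.
move=> [p0 pU pP]; elim: ps => [|q ps IH].
  rewrite big_nil => -[c /esym cp]; case/negP: pU; apply/unitrP.
  by exists c; split; rewrite // mulrC.
rewrite big_cons => /pP[pq|/IH[r rps pr]].
  by exists q; rewrite ?mem_head.
by exists r; rewrite // inE rps orbT.
Qed.

Lemma prime_unit_mul (R : idomainType) (p u a : R) :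
  u \is a GRing.unit -> divides p (u * a) -> divides p a.
Proof.
move=> uU [c e]; exists (u^-1 * c).
by rewrite -mulrA -e mulrA mulVr // mul1r.
Qed.

Lemma factorial_irreducible_prime (R : idomainType) (a : R) :
  factorial_ring R -> irreducible_elt a -> prime_elt a.
Proof.
move=> Rf [a0 aU aP]; have [u [ps [uU psP aE]]] := Rf a a0.
case: ps psP aE => [|p ps] psP aE.
  by move: aU; rewrite aE big_nil mulr1 uU.
have pp : prime_elt p by apply: psP; rewrite mem_head.
case: (pp) => p0 pU pP.
move: aE; rewrite big_cons mulrCA => aE.
have vU : (u * \prod_(j <- ps) j) \is a GRing.unit.
  by case/orP: (aP _ _ aE) => // pU'; rewrite pU' in pU.
move: (u * _) vU aE => v vU aE.
have dvE b : divides a b <-> divides p b.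
  split=> -[c ->]; first by exists (c * v); rewrite aE mulrCA mulrC -mulrA mulrC.
  by exists (c / v); rewrite aE [p * v]mulrC mulrA divrK.
by split=> // b c /dvE/pP[] /dvE; [left|right].
Qed.

Lemma factorial_iso (R S : idomainType) (f : {rmorphism R -> S}) (g : S -> R) :
  cancel f g -> cancel g f -> factorial_ring R -> factorial_ring S.
Proof.
move=> fK gK Rf a a0.
have gM x y : g (x * y) = g x * g y.
  by apply: (can_inj fK); rewrite gK rmorphM !gK.
have g0 x : (g x == 0) = (x == 0).
  by rewrite -(inj_eq (can_inj fK)) gK rmorph0.
have fU x : (f x \is a GRing.unit) = (x \is a GRing.unit).
  apply/idP/idP => [/unitrP[y [yx xy]]|]; last exact: rmorph_unit.
  apply/unitrP; exists (g y); split; apply: (can_inj fK);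
  by rewrite rmorphM gK rmorph1.
have [|u [ps [uU psP aE]]] := Rf (g a); first by rewrite g0.
exists (f u), (map f ps); split; first by rewrite fU.
  move=> _ /mapP[p /psP[p0 pU pP] ->]; split.
  - by rewrite -g0 fK.
  - by rewrite fU.
  - move=> b c [d bc].
    have /pP[[e E]|[e E]] : divides p (g b * g c).
    + by exists (g d); rewrite -gM bc gM fK.
    + by left; exists (f e); rewrite -rmorphM -E gK.
    + by right; exists (f e); rewrite -rmorphM -E gK.
by rewrite big_map -rmorph_prod -rmorphM -aE gK.
Qed.

Lemma int_unit (a : int) : `|a|%N = 1%N -> a \is a GRing.unit.
Proof. by case: a => [[|[|n]]|[|n]]. Qed.

Lemma factorial_int : factorial_ring int.
Proof.
move=> a; have [n] := ubnP `|a|%N; elim: n a => // n IH a an a0.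
have [a1|a1] := eqVneq `|a|%N 1%N.
  by exists a, [::]; rewrite big_nil mulr1; split=> //; apply: int_unit.
have ha : (1 < `|a|)%N by rewrite ltn_neqAle eq_sym a1 lt0n absz_eq0.
have pp := pdiv_prime ha; set p := pdiv _ in pp.
have /dvdzP[b aE] : (p%:Z %| a)%Z by rewrite dvdzE /= pdiv_dvd.
have b0 : b != 0 by apply: contraNneq a0 => b0; rewrite aE b0 mul0r.
have [|u [ps [uU psP bE]]] := IH b _ b0.
  rewrite ltnS in an; apply: leq_trans an.
  by rewrite aE abszM /= ltn_Pmulr ?prime_gt1 // lt0n absz_eq0.
exists u, (p%:Z :: ps); split=> //.
  move=> q; rewrite inE => /orP[/eqP->|/psP//]; split.
  - by case: p pp {aE}.
  - by move: pp {aE}; case: p => [|[|]].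
  - move=> c d [e cd].
    have : (p%:Z %| c * d)%Z by apply/dvdzP; exists e.
    by rewrite dvdzE abszM Euclid_dvdM // => /orP[] h; [left|right]; apply/dvdzP.
by rewrite big_cons aE {1}bE mulrCA mulrC.
Qed.

Section FactorialPoly.
Variable R : idomainType.
Hypothesis Rf : factorial_ring R.
Implicit Types (p c : R) (f g h : {poly R}).

Lemma polyC_prime p : prime_elt p -> prime_elt p%:P.
Proof.
move=> [p0 pU pP]; split; first by rewrite polyC_eq0.
  by rewrite poly_unitE coefC eqxx size_polyC p0.
move=> f g; have [n] := ubnP (size f + size g)%N.
elim: n f g => // n IH f g fgn fg.
have [->|f0] := eqVneq f 0; first by left; exists 0; rewrite mul0r.
have [->|g0] := eqVneq g 0; first by right; exists 0; rewrite mul0r.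
have aux (f1 g1 : {poly R}) : f1 != 0 -> (size f1 + size g1 <= n)%N ->
    divides p%:P (f1 * g1) -> divides p (lead_coef f1) ->
    divides p%:P f1 \/ divides p%:P g1.
  move=> f10 fg1n [q fg1] [c lc].
  set r : {poly R} := c *: 'X^((size f1).-1).
  have rE : r * p%:P = lead_coef f1 *: 'X^((size f1).-1).
    by rewrite mulrC mul_polyC scalerA mulrC -lc.
  have sf : (size (f1 - r * p%:P)%R < size f1)%N.
    have sz : (0 < size f1)%N by rewrite lt0n size_poly_eq0.
    rewrite -[X in (_ < X)%N](prednK sz) ltnS; apply/leq_sizeP => j.
    rewrite leq_eqVlt => /orP[/eqP <-|hj].
      by rewrite rE coefB coefZ coefXn eqxx mulr1 lead_coefE subrr.
    rewrite rE coefB coefZ coefXn nth_default ?gtn_eqF ?mulr0 ?subr0 //.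
    by rewrite -(prednK sz).
  have [||[q1 e]|[q1 e]] := IH (f1 - r * p%:P) g1.
  - by apply: leq_trans fg1n; rewrite ltn_add2r.
  - by exists (q - r * g1); rewrite !mulrBl fg1 mulrAC.
  - by left; exists (q1 + r); rewrite mulrDl -e subrK.
  - by right; exists q1.
have /pP[] : divides p (lead_coef f * lead_coef g).
  by case: fg => q e; exists (lead_coef q); rewrite -lead_coefM e lead_coefM lead_coefC.
  by apply: aux.
move=> lg; have [|||//] := aux g f g0 _ _ lg; last 2 first.
- by right.
- by left.
- by rewrite addnC.
by rewrite mulrC.
Qed.

Definition primitive_poly f := forall p, prime_elt p -> ~ divides p%:P f.

Lemma primitive_cancel f g h c : primitive_poly f -> c != 0 ->
  c *: g = h * f -> divides f g.
Proof.
move=> fP /Rf[u [ps [uU psP ->]]] {c}.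
elim: ps psP h => [|p ps IH] psP h.
  rewrite big_nil mulr1 => e; exists (u^-1 *: h).
  by rewrite -scalerAl -e scalerA mulVr // scale1r.
rewrite big_cons mulrCA -scalerA => e.
have pp : prime_elt p by apply: psP; rewrite mem_head.
have [p0 _ _] := pp; have [_ _ pP] := polyC_prime pp.
have /pP[[h1 hE]|/(fP _ pp)//] : divides p%:P (h * f).
  by rewrite -e; exists ((u * \prod_(q <- ps) q) *: g); rewrite [_ * p%:P]mulrC mul_polyC.
apply: (IH _ h1) => [q qps|]; first by apply: psP; rewrite inE qps orbT.
have pX0 : p%:P != 0 by rewrite polyC_eq0.
by apply: (mulfI pX0); rewrite mul_polyC e hE -mulrA mulrCA.
Qed.

Lemma primitive_unit c : c != 0 ->
  (forall p, prime_elt p -> ~ divides p c) -> c \is a GRing.unit.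
Proof.
move=> /Rf[u [[|p ps] [uU psP ->]]] cP; first by rewrite big_nil mulr1.
case: (cP p); first by apply: psP; rewrite mem_head.
by exists (u * \prod_(q <- ps) q); rewrite big_cons mulrCA mulrC.
Qed.

Lemma primitive_partP f : f != 0 ->
  exists c f1, [/\ c != 0, primitive_poly f1 & f = c *: f1].
Proof.
move=> f0; have := f0; rewrite -lead_coef_eq0 => /Rf[u [ps [uU psP lf]]].
have [n] := ubnP (size ps); elim: n f f0 u ps uU psP lf => // n IH f f0 u ps uU psP lf psn.
have [fP|] := pselect (primitive_poly f).
  by exists 1, f; rewrite oner_neq0 scale1r.
move=> /existsNP[p /not_implyP[pp /contrapT[g fE]]].
have g0 : g != 0 by apply: contraNneq f0 => g0; rewrite fE g0 mul0r.
have lg : lead_coef f = p * lead_coef g.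
  by rewrite fE lead_coefM lead_coefC mulrC.
have /(prime_unit_mul uU)/(prime_prod pp)[q qps [w qE]] :
    divides p (u * \prod_(q <- ps) q).
  by exists (lead_coef g); rewrite -lf lg mulrC.
have [p0 pU _] := pp.
have wU : w \is a GRing.unit.
  have /prime_irreducible[_ _ /(_ _ _ qE)] := psP _ qps.
  by rewrite (negPf pU) orbF.
have [||||c [g1 [c0 g1P gE]]] := IH g g0 (u * w) (rem q ps).
- by rewrite unitrM uU.
- by move=> r /mem_rem/psP.
- apply: (mulfI p0); rewrite -lg lf (big_rem _ qps) /= qE.
  by rewrite -!mulrA [p * (u * _)]mulrCA [p * (w * _)]mulrCA.
- by rewrite size_rem // -ltnS prednK //; case: (ps) qps.
exists (p * c), g1; split; rewrite ?mulf_neq0 //.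
by rewrite fE gE mulrC mul_polyC scalerA.
Qed.

Lemma primitive_factor f g h : f = g * h -> primitive_poly f -> primitive_poly g.
Proof.
move=> fE fP p pp [q gE]; apply: (fP p pp).
by exists (q * h); rewrite fE gE mulrAC.
Qed.

Lemma primitive_const_unit c f : f != 0 -> primitive_poly f -> divides c%:P f ->
  c \is a GRing.unit.
Proof.
move=> f0 fP [g fE]; apply: primitive_unit.
  by apply: contraNneq f0 => c0; rewrite fE c0 mulr0.
move=> p pp [d cE]; apply: (fP p pp); exists (g * d%:P).
by rewrite fE cE polyCM mulrA.
Qed.

Lemma primitive_indecomposable_prime f : (1 < size f)%N -> primitive_poly f ->
  (forall g h, f = g * h -> (size g <= 1)%N \/ (size h <= 1)%N) -> prime_elt f.
Proof.
move=> sf fP find; have f0 : f != 0 by rewrite -size_poly_gt0 (ltn_trans _ sf).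
split=> //; first by rewrite poly_unitE gtn_eqF.
move=> a b [q ab].
have strip (g h : {poly R}) : primitive_poly g -> g %| h -> divides g h.
  by move=> gP /Pdiv.Idomain.dvdpP[[c k] /= c0 e]; apply: (primitive_cancel gP c0 e).
set d := gcdp f a.
have d0 : d != 0 by rewrite gcdp_eq0 (negPf f0).
have [c [d1 [c0 d1P dE]]] := primitive_partP d0.
have dd1 g : (d1 %| g) = (d %| g) by rewrite dE dvdpZl.
have [e fE] : divides d1 f by apply: strip; rewrite // dd1 dvdp_gcdl.
have [se|sd] := find _ _ fE.
  left; have [e1 eE] : exists e1, e = e1%:P by exists e`_0; apply: size1_polyC.
  have e1U : e1 \is a GRing.unit.
    by apply: (primitive_const_unit f0 fP); exists d1; rewrite fE eE mulrC.
  have [k aE] : divides d1 a by apply: strip; rewrite // dd1 dvdp_gcdr.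
  exists (e1^-1 *: k); rewrite -scalerAl fE eE mul_polyC -scalerAr scalerA.
  by rewrite mulVr // scale1r.
right; apply: strip => //; rewrite -(@Gauss_dvdpr _ b a f).
  by rewrite ab dvdp_mull.
rewrite coprimep_def -/d dE size_scale // eqn_leq sd /= size_poly_gt0.
by apply: contraNneq d0 => d10; rewrite dE d10 scaler0.
Qed.

Lemma factorial_poly : factorial_ring {poly R}.
Proof.
have prim f : f != 0 -> primitive_poly f -> exists (u : {poly R}) (ps : seq {poly R}),
    [/\ u \is a GRing.unit, (forall q, q \in ps -> prime_elt q)
      & f = u * \prod_(q <- ps) q].
  have [n] := ubnP (size f); elim: n f => // n IH f fn f0 fP.
  have [sf|sf] := leqP (size f) 1.
    have [c cE] : exists c, f = c%:P by exists f`_0; apply: size1_polyC.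
    have cU : c \is a GRing.unit.
      by apply: (primitive_const_unit f0 fP); exists 1; rewrite mul1r.
    exists f, [::]; rewrite big_nil mulr1; split=> //.
    by rewrite cE; apply: rmorph_unit.
  have [find|] := pselect (forall g h, f = g * h -> (size g <= 1)%N \/ (size h <= 1)%N).
    exists 1, [:: f]; rewrite unitr1 big_seq1 mul1r; split=> // p.
    by rewrite inE => /eqP->; apply: primitive_indecomposable_prime.
  move=> /existsNP[g /existsNP[h /not_implyP[fE /not_orP[/negP sg /negP sh]]]].
  rewrite -!ltnNge in sg sh.
  have g0 : g != 0 by rewrite -size_poly_gt0 (ltn_trans _ sg).
  have h0 : h != 0 by rewrite -size_poly_gt0 (ltn_trans _ sh).
  have hg : f = h * g by rewrite mulrC.
  move: fn; rewrite fE size_mul // ltnS => ghn.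
  have [|u [ps [uU psP gE]]] := IH g _ g0 (primitive_factor fE fP).
    by apply: leq_trans ghn; move: sg sh; case: (size g) (size h) => // m [|[|k]] // _ _; rewrite !addnS ltnS /= leq_addr.
  have [|v [qs [vU qsP hE]]] := IH h _ h0 (primitive_factor hg fP).
    by apply: leq_trans ghn; move: sg sh; case: (size g) (size h) => [|[|m]] // k _ _; rewrite !addSn ltnS /= leq_addl.
  exists (u * v), (ps ++ qs); split; first by rewrite unitrM uU.
    by move=> p; rewrite mem_cat => /orP[/psP|/qsP].
  by rewrite big_cat /= {1}gE {1}hE mulrACA.
move=> f /[dup] f0 /primitive_partP[c [g [c0 gP fE]]].
have g0 : g != 0 by apply: contraNneq f0 => g0; rewrite fE g0 scaler0.
have [u [ps [uU psP gE]]] := prim g g0 gP.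
have [v [qs [vU qsP cE]]] := Rf c0.
exists (v%:P * u), (map polyC qs ++ ps); split.
- by rewrite unitrM uU andbT; apply: rmorph_unit.
- move=> p; rewrite mem_cat => /orP[/mapP[q /qsP qp ->]|/psP//].
  exact: polyC_prime.
- by rewrite big_cat big_map /= -rmorph_prod mulrACA -polyCM -cE -gE mul_polyC.
Qed.

End FactorialPoly.

Lemma factorial_mpoly n : factorial_ring {mpoly int[n]}.
Proof.
elim: n => [|n IH].
  apply: (@factorial_iso _ _ (@mpolyC 0 int) (fun p => p@_0%MM)) factorial_int.
    by move=> c /=; rewrite mcoeffC eqxx mulr1.
  move=> p /=; apply/mpolyP => m; rewrite mcoeffC.
  by rewrite (_ : m = 0%MM) ?eqxx ?mulr1 //; apply/mnmP => -[].
have wC : commr_rmorph (@mwiden n int) 'X_ord_max by move=> x; apply: mulrC.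
pose F : {rmorphism {poly {mpoly int[n]}} -> {mpoly int[n.+1]}} := horner_morph wC.
have FC c : F c%:P = mwiden c by exact: horner_morphC.
have FX : F 'X = 'X_ord_max by exact: horner_morphX.
have FK : cancel (@muni n int) F.
  move=> p; rewrite muniE rmorph_sum /= [RHS]mpolyE; apply: eq_bigr => m _.
  rewrite -mul_polyC rmorphM rmorphXn /= FC FX mwidenZ mwidenX -scalerAl; congr (_ *: _).
  rewrite mpolyXn -mpolyXD; congr 'X_[_]; apply/mnmP => i.
  rewrite mnmDE mulmnE mnm1E.
  have [j ->|->] := unliftP ord_max i.
    rewrite (_ : lift ord_max j = widen_ord (leqnSn n) j); last first.
      by apply: val_inj; rewrite /= /bump leqNgt ltn_ord.
    rewrite mnmwiden_widen mnmE eqE /= gtn_eqF ?ltn_ord //.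
    by rewrite mul0n addn0.
  by rewrite eqxx mul1n [X in (X + _)%N](mnmwiden_ordmax [multinom m (widen_ord (leqnSn n) k) | k < n]).
have muniX (j : 'I_n) : muni (R := int) 'X_(widen_ord (leqnSn n) j) = ('X_j)%:P.
  rewrite muniE msuppX big_seq1 mcoeffX eqxx scale1r.
  rewrite mnm1E eqE /= ltn_eqF ?ltn_ord // expr0.
  rewrite alg_polyC; congr ('X_[_])%:P; apply/mnmP => k.
  by rewrite !mnmE eqE.
have muniXm : muni (R := int) 'X_(@ord_max n) = 'X.
  rewrite muniE msuppX big_seq1 mcoeffX eqxx scale1r mnm1E eqxx expr1.
  rewrite (_ : [multinom _ | _ < _] = 0%MM) ?mpolyX0 ?scale1r //.
  by apply/mnmP => k; rewrite mnmE mnm1E mnm0E eqE /= gtn_eqF.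
have muniW (q : {mpoly int[n]}) : muni (mwiden q) = q%:P.
  elim/mpolyind: q => [|c m q _ _ IHq]; first by rewrite mwiden0 muni0 polyC0.
  rewrite mwidenD muniD IHq mwidenZ muniZ polyCD; congr (_ + _).
  rewrite -mul_mpolyC polyCM mul_polyC; congr (_ *: _).
  rewrite /mwiden mmapX /mmap1 [in RHS]mpolyXE_id [in RHS]rmorph_prod /= rmorph_prod /=.
  by apply: eq_bigr => i _; rewrite !rmorphXn /= muniX.
apply: (@factorial_iso _ _ F (@muni n int)) (factorial_poly IH) => //.
move=> p; elim/poly_ind: p => [|p c IHp]; first by rewrite rmorph0 muni0.
by rewrite rmorphD rmorphM muniD muniM IHp /= FC FX muniW muniXm.
Qed.

Definition map_Q n (f : {mpoly int[n]}) : {mpoly rat[n]} :=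
  map_mpoly intr f.

Lemma map_Q_inj n : injective (@map_Q n).
Proof.
move=> f g /mpolyP e; apply/mpolyP => m.
by have := e m; rewrite !mcoeff_map_mpoly => /intr_inj.
Qed.

Lemma clear_denominators n (p : {mpoly rat[n]}) :
  exists (d : int) (q : {mpoly int[n]}), d != 0 /\ d%:~R *: p = map_Q q.
Proof.
elim/mpolyind: p => [|c m p _ _ [d [q [d0 dq]]]].
  by exists 1, 0; rewrite scaler0 /map_Q rmorph0.
exists (denq c * d), ((d * numq c) *: 'X_[m] + denq c *: q); split.
  by rewrite mulf_neq0 ?denq_neq0.
rewrite scalerDr intrM -[in X in _ + X]scalerA dq /map_Q rmorphD /= !map_mpolyZ /=.
rewrite map_mpolyX scalerA; congr (_ *: _ + _).
by rewrite intrM -mulrA mulrCA [_ * c]mulrC numqE.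
Qed.

Lemma dvd_scale_int n (f g : {mpoly int[n]}) (d : int) : (1 < msize f)%N ->
  prime_elt f -> d != 0 -> divides f (d *: g) -> divides f g.
Proof.
move=> sf [f0 _ fP] d0; rewrite -mul_mpolyC => /fP[[q e]|//].
have q0 : q != 0.
  by apply: contraNneq d0 => q0; rewrite -(mpolyC_eq0 n) e q0 mul0r.
have := congr1 (fun p => msize p) e; rewrite msizeM // (mpolySpred _ q0) msizeC d0.
by case: (msize f) sf => [|[|k]] //; rewrite !addnS.
Qed.

Lemma map_Q_prime n (f : {mpoly int[n]}) : (1 < msize f)%N ->
  irreducible_elt f -> prime_elt (map_Q f).
Proof.
move=> sf /(factorial_irreducible_prime (@factorial_mpoly n)) fp.
have [f0 fU fP] := fp; split.
- by rewrite -(inj_eq (@map_Q_inj n)) /map_Q rmorph0 in f0.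
- apply/negP => /unitrP[g [gf _]].
  have [d [q [d0 dq]]] := clear_denominators g.
  have : divides f (d *: 1).
    by exists q; apply: map_Q_inj; rewrite /map_Q rmorphM /= -/(map_Q q) -dq -scalerAl gf map_mpolyZ rmorph1.
  move/(dvd_scale_int sf fp d0) => -[h hf]; case/negP: fU; apply/unitrP.
  by exists h; split; rewrite // mulrC.
- move=> g h [k gh].
  have [d1 [g1 [d10 E1]]] := clear_denominators g.
  have [d2 [h1 [d20 E2]]] := clear_denominators h.
  have [d3 [k1 [d30 E3]]] := clear_denominators k.
  have : divides f (d3 *: (g1 * h1)).
    exists ((d1 * d2) *: k1); apply: map_Q_inj.
    rewrite /map_Q map_mpolyZ !rmorphM /= !map_mpolyZ ?rmorphM /= -/(map_Q g1) -/(map_Q h1) -/(map_Q k1) -/(map_Q f).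
    rewrite -E1 -E2 -E3; rewrite -!scalerAl -!scalerAr gh !scalerA; congr (_ *: _).
    by rewrite -mulrA mulrC.
  move/(dvd_scale_int sf fp d30)/fP.
  have back (e : int) (a : {mpoly rat[n]}) a1 : e != 0 -> e%:~R *: a = map_Q a1 ->
      divides f a1 -> divides (map_Q f) a.
    move=> e0 ea [q aE]; exists (e%:~R^-1 *: map_Q q).
    rewrite -scalerAl /map_Q -rmorphM /= -aE -/(map_Q a1) -ea scalerA mulVf ?scale1r //.
    by rewrite intr_eq0.
  by case=> hd; [left; apply: back E1 hd|right; apply: back E2 hd].
Qed.

(* Irreducibility is meant in Z[X, Y, Z]. *)
Record plane_curve := PlaneCurve {
  curve_poly :> {mpoly int[3]};
  curve_deg : nat;
  curve_deg_gt0 : (1 <= curve_deg)%N;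
  curve_homog : curve_poly \is curve_deg.-homog;
  curve_irreducible : irreducible_elt curve_poly
}.

Lemma curve_prime (C : plane_curve) : prime_elt (map_Q C).
Proof.
apply: map_Q_prime (curve_irreducible C); have [f0 _ _] := curve_irreducible C.
have := curve_homog C; move=> /[dup] /dhomog_msize h /(dhomog_uniq f0)/(_ h).
by have := curve_deg_gt0 C; case: (msize C) => [|[|k]] //= + e; rewrite e.
Qed.

Definition curve_ideal (C : plane_curve) : {pred {mpoly rat[3]}} :=
  fun g => `[< divides (map_Q C) g >].

Lemma curve_ideal_closed C : idealr_closed (curve_ideal C).
Proof.
have [f0 fU _] := curve_prime C; split.
- by apply/asboolP; exists 0; rewrite mul0r.
- apply/negP => /asboolP[g gf]; case/negP: fU; apply/unitrP.
  by exists g; split; rewrite // mulrC.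
- move=> a u v /asboolP[g ->] /asboolP[h ->]; apply/asboolP.
  by exists (a * g + h); rewrite mulrDl mulrA.
Qed.

Lemma curve_ideal_prime C : prime_idealr_closed (curve_ideal C).
Proof.
have [_ _ fP] := curve_prime C => u v /asboolP/fP[] h; apply/orP;
by [left; apply/asboolP | right; apply/asboolP].
Qed.

HB.instance Definition _ C :=
  isIdealr.Build {mpoly rat[3]} (curve_ideal C) (curve_ideal_closed C).
HB.instance Definition _ C :=
  isPrimeIdealrClosed.Build {mpoly rat[3]} (curve_ideal C) (@curve_ideal_prime C).

(* The homogeneous coordinate ring Q[X, Y, Z] / (f). *)
Definition coord_ring (C : plane_curve) : Type := {ideal_quot (curve_ideal C)}.

HB.instance Definition _ C := GRing.ComNzRing.on (coord_ring C).

Section CoordRingUnits.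
Variable C : plane_curve.
Implicit Types x y : coord_ring C.

(* Field of fractions in MathComp is only defined over an [idomainType], which
   includes a partial inverse; it is chosen classically. *)
Definition coord_unit : pred (coord_ring C) := fun x => `[< exists y, y * x = 1 >].

Definition coord_inv x : coord_ring C :=
  match pselect (exists y, y * x = 1) with
  | left h => projT1 (cid h)
  | right _ => x
  end.

Lemma coord_mulVx : {in coord_unit, left_inverse 1 coord_inv *%R}.
Proof.
move=> x /asboolP xU; rewrite /coord_inv; case: pselect => // h.
by case: (cid h).
Qed.

Lemma coord_unitPl x y : y * x = 1 -> coord_unit x.
Proof. by move=> h; apply/asboolP; exists y. Qed.

Lemma coord_inv_out : {in [predC coord_unit], coord_inv =1 id}.
Proof.
by move=> x /asboolP xU; rewrite /coord_inv; case: pselect.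
Qed.

HB.instance Definition _ := GRing.ComNzRing_hasMulInverse.Build (coord_ring C)
  coord_mulVx coord_unitPl coord_inv_out.

Lemma coord_domain x y : x * y = 0 -> (x == 0) || (y == 0).
Proof. exact: Quotient.rquot_IdomainAxiom. Qed.

HB.instance Definition _ :=
  GRing.ComUnitRing_isIntegral.Build (coord_ring C) coord_domain.
End CoordRingUnits.

Definition coord_class (C : plane_curve) (g : {mpoly rat[3]}) : coord_ring C :=
  \pi_(coord_ring C)%qT g.

(* The class of g / h in the field of fractions of Q[X, Y, Z] / (f). *)
Definition hfrac (C : plane_curve) (g h : {mpoly rat[3]}) : {fraction (coord_ring C)} :=
  FracField.tofrac (coord_class C g) / FracField.tofrac (coord_class C h).

Definition homog_frac (C : plane_curve) : {pred {fraction (coord_ring C)}} :=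
  fun r => `[< exists d g h, [/\ g \is d.-homog, h \is d.-homog,
                 h \notin curve_ideal C & r = hfrac C g h] >].

Section HomogFrac.
Variable C : plane_curve.
Implicit Types g h : {mpoly rat[3]}.

Lemma coord_class_eq0 g : (coord_class C g == 0) = (g \in curve_ideal C).
Proof.
by rewrite /coord_class (_ : 0 = \pi_(coord_ring C)%qT 0) -?Quotient.idealrBE ?subr0 ?pi_zeror.
Qed.

Lemma coord_classD g h : coord_class C (g + h) = coord_class C g + coord_class C h.
Proof. by rewrite /coord_class pi_addr. Qed.

Lemma coord_classN g : coord_class C (- g) = - coord_class C g.
Proof. by rewrite /coord_class pi_oppr. Qed.

Lemma coord_classM g h : coord_class C (g * h) = coord_class C g * coord_class C h.
Proof. by rewrite /coord_class pi_mulr. Qed.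

Lemma coord_class1 : coord_class C 1 = 1.
Proof. by rewrite /coord_class pi_oner. Qed.

Lemma curve_ideal0 : 0 \in curve_ideal C.
Proof. exact: idealr0. Qed.

Lemma curve_ideal1 : 1 \notin curve_ideal C.
Proof. by rewrite idealr1. Qed.

Lemma curve_idealM g h :
  (g * h \in curve_ideal C) = (g \in curve_ideal C) || (h \in curve_ideal C).
Proof. exact: prime_idealrM. Qed.

Lemma homog_frac_closed : divring_closed (@homog_frac C).
Proof.
have den0 h : h \notin curve_ideal C -> FracField.tofrac (coord_class C h) != 0.
  by rewrite tofrac_eq0 coord_class_eq0.
have notin g h : g \notin curve_ideal C -> h \notin curve_ideal C ->
    g * h \notin curve_ideal C.
  by move=> g0 h0; rewrite curve_idealM negb_or g0 h0.
split.
- apply/asboolP; exists 0%N, 1, 1; rewrite dhomog1 curve_ideal1; split=> //.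
  by rewrite /hfrac coord_class1 tofrac1 divr1.
- move=> x y /asboolP[d [g [h [gd hd h0 ->]]]] /asboolP[e [g1 [h1 [g1e h1e h10 ->]]]].
  apply/asboolP; exists (d + e)%N, (g * h1 - g1 * h), (h * h1).
  split; [|exact: dhomogM|exact: notin|].
    by apply: rpredB; [|rewrite addnC]; apply: dhomogM.
  rewrite /hfrac coord_classD coord_classN !coord_classM tofracD tofracN !tofracM.
  by rewrite -mulNr addf_div ?den0 // mulNr.
- move=> x y /asboolP[d [g [h [gd hd h0 ->]]]] /asboolP[e [g1 [h1 [g1e h1e h10 ->]]]].
  apply/asboolP; have [g10|g10] := boolP (g1 \in curve_ideal C).
    exists 0%N, 0, 1; rewrite dhomog1 dhomog0 curve_ideal1; split=> //.
    move: g10; rewrite /hfrac -coord_class_eq0 => /eqP->.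
    have /eqP-> : coord_class C 0 == 0 by rewrite coord_class_eq0 curve_ideal0.
    by rewrite tofrac0 !mul0r invr0 mulr0.
  exists (d + e)%N, (g * h1), (h * g1).
  split; [exact: dhomogM|exact: dhomogM|exact: notin|].
  by rewrite /hfrac !coord_classM !tofracM invf_div mulf_div.
Qed.

HB.instance Definition _ :=
  GRing.isDivringClosed.Build {fraction (coord_ring C)} (@homog_frac C) homog_frac_closed.

End HomogFrac.

(* Q(C_f): the degree zero part of the homogeneous field of fractions, i.e. the
   quotients g / h of forms of the same degree with h not divisible by f. *)
Record function_field (C : plane_curve) := FunctionField {
  ff_val :> {fraction (coord_ring C)};
  ff_valP : ff_val \in @homog_frac C
}.

Section FF.
Variable C : plane_curve.
HB.instance Definition _ := [isSub for @ff_val C].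
HB.instance Definition _ := [Choice of function_field C by <:].
HB.instance Definition _ := [SubChoice_isSubIntegralDomain of function_field C by <:].

Lemma function_field_axiom : GRing.field_axiom (function_field C).
Proof.
move=> x x0; have v0 : ff_val x != 0 by have := x0; rewrite -(inj_eq val_inj) rmorph0.
have yP : (ff_val x)^-1 \in @homog_frac C by rewrite rpredV ff_valP.
apply/unitrP; exists (FunctionField yP).
by split; apply: val_inj; rewrite rmorphM rmorph1 /= ?mulVf ?mulfV.
Qed.
HB.instance Definition _ := GRing.UnitRing_isField.Build (function_field C) function_field_axiom.
End FF.

(* The value [dval v 0] is irrelevant: 0 plays the role of an element of infinite
   valuation.  A subring of K is a discrete valuation ring of the field K when it
   is [dvr v] for a discrete valuation v; [dvr_max v] is its maximal ideal. *)
Record discrete_valuation (K : fieldType) := DiscreteValuation {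
  dval :> K -> int;
  dvalM : forall x y, x != 0 -> y != 0 -> dval (x * y) = dval x + dval y;
  dvalD : forall x y, x != 0 -> y != 0 -> x + y != 0 ->
    Num.min (dval x) (dval y) <= dval (x + y);
  dval_surj : forall k, exists2 x, x != 0 & dval x = k
}.

Definition dvr (K : fieldType) (v : discrete_valuation K) : {pred K} :=
  fun x => (x == 0) || (0 <= v x).

Definition dvr_max (K : fieldType) (v : discrete_valuation K) : {pred K} :=
  fun x => (x == 0) || (0 < v x).

Section DiscreteValuation.
Variables (K : fieldType) (v : discrete_valuation K).

Lemma dval1 : v 1 = 0.
Proof.
by apply: (addrI (v 1)); rewrite -dvalM ?oner_neq0 // mul1r addr0.
Qed.

Lemma dvalN x : x != 0 -> v (- x) = v x.
Proof.
move=> x0; have n10 : (-1 : K) != 0 by rewrite oppr_eq0 oner_neq0.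
have : v (-1) *+ 2 = 0 by rewrite mulr2n -dvalM // mulrNN mulr1 dval1.
move/eqP; rewrite mulrn_eq0 /= => /eqP v0.
by rewrite -mulN1r dvalM // v0 add0r.
Qed.

Lemma dvr_maxW x : x \in dvr_max v -> x \in dvr v.
Proof. by rewrite !unfold_in /dvr /dvr_max => /orP[->//|/ltW ->]; rewrite orbT. Qed.

Lemma dvr_max_subr x y : x \in dvr_max v -> y \in dvr_max v -> x - y \in dvr_max v.
Proof.
rewrite !unfold_in /dvr /dvr_max.
have [->|x0] /= := eqVneq x 0; have [->|y0] /= := eqVneq y 0; rewrite ?subr0 ?eqxx //.
- by rewrite sub0r oppr_eq0 (negPf y0) dvalN.
- by move=> -> _; rewrite orbT.
have [//|xy0] /= := eqVneq (x - y) 0 => vx vy.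
apply: (lt_le_trans _ (dvalD v x0 _ xy0)); rewrite ?oppr_eq0 //.
by rewrite dvalN // lt_min vx.
Qed.

Lemma dvr_max_mull x y : x \in dvr v -> y \in dvr_max v -> x * y \in dvr_max v.
Proof.
rewrite !unfold_in /dvr /dvr_max mulf_eq0.
have [->|x0] //= := eqVneq x 0; have [->|y0] //= := eqVneq y 0 => vx vy.
by rewrite dvalM // ltr_wpDl.
Qed.

Lemma dvr_closed : subring_closed (dvr v).
Proof.
split=> [|x y|x y]; rewrite  !unfold_in /dvr /dvr_max; first by rewrite dval1 lexx orbT.
- have [->|x0] /= := eqVneq x 0; have [->|y0] /= := eqVneq y 0; rewrite ?subr0 ?eqxx //.
  + by rewrite sub0r oppr_eq0 (negPf y0) dvalN.
  + by move=> -> _; rewrite orbT.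
  have [//|xy0] /= := eqVneq (x - y) 0 => vx vy.
  apply: (le_trans _ (dvalD v x0 _ xy0)); rewrite ?oppr_eq0 //.
  by rewrite dvalN // le_min vx.
- rewrite mulf_eq0.
  have [->|x0] //= := eqVneq x 0; have [->|y0] //= := eqVneq y 0 => vx vy.
  by rewrite dvalM // addr_ge0.
Qed.

HB.instance Definition _ := GRing.isSubringClosed.Build K (dvr v) dvr_closed.

Record dvr_type := DvrType { dvr_val :> K; dvr_valP : dvr_val \in dvr v }.
HB.instance Definition _ := [isSub for dvr_val].
HB.instance Definition _ := [Choice of dvr_type by <:].
HB.instance Definition _ := [SubChoice_isSubComNzRing of dvr_type by <:].

Definition dvr_max_ideal : {pred dvr_type} := fun x => val x \in dvr_max v.

Lemma dvr_max_ideal_closed : idealr_closed dvr_max_ideal.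
Proof.
split=> [||a x y xm ym].
- by rewrite unfold_in /dvr_max_ideal rmorph0 unfold_in /dvr_max eqxx.
- by rewrite unfold_in /dvr_max_ideal rmorph1 unfold_in /dvr_max oner_eq0 dval1 ltxx.
- rewrite unfold_in /dvr_max_ideal -[y]opprK rmorphB rmorphM; apply: dvr_max_subr.
    by apply: dvr_max_mull xm; apply: dvr_valP.
  by rewrite rmorphN -sub0r; apply: dvr_max_subr ym; rewrite unfold_in /dvr_max eqxx.
Qed.

HB.instance Definition _ :=
  isIdealr.Build dvr_type dvr_max_ideal dvr_max_ideal_closed.

Definition residue_field : comNzRingType := {ideal_quot dvr_max_ideal}.
End DiscreteValuation.

(* Ring isomorphism; between fields of characteristic 0 it is Q-linear. *)
Definition ring_isom (R S : nzRingType) : Prop :=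
  exists phi : {rmorphism R -> S}, bijective phi.

Definition integer_valued (m : nat) (phi : {mpoly rat[m]}) : Prop :=
  forall x : 'I_m -> int, phi.@[fun i => (x i)%:~R] \is a Num.int.

(* Points of P^2 over the algebraic numbers are given by nonzero vectors of
   homogeneous coordinates; see [bad_pointZ] for independence of the choice. *)
Section Points.
Variable C : plane_curve.
Implicit Types (p : 'I_3 -> algC) (v : discrete_valuation (function_field C)).

Definition eval_algC (p : 'I_3 -> algC) (g : {mpoly rat[3]}) : algC :=
  (map_mpoly ratr g).@[p].

Definition on_curve p : Prop := (exists i, p i != 0) /\ eval_algC p (map_Q C) = 0.

Definition local_ring p (r : function_field C) : Prop :=
  exists d g h, [/\ g \is d.-homog, h \is d.-homog, eval_algC p h != 0
    & ff_val r = hfrac C g h].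

Definition local_max p (r : function_field C) : Prop :=
  exists d g h, [/\ g \is d.-homog, h \is d.-homog, eval_algC p h != 0,
    eval_algC p g = 0 & ff_val r = hfrac C g h].

(* A point is singular when its local ring is not a discrete valuation ring. *)
Definition singular p : Prop :=
  ~ exists v, forall r, local_ring p r <-> r \in dvr v.

Definition lies_above v p : Prop :=
  (forall r, local_ring p r -> r \in dvr v) /\
  (forall r, local_max p r -> r \in dvr_max v).

Definition bad_point p : Prop :=
  [/\ on_curve p, singular p &
      ~ exists v, lies_above v p /\ ring_isom (residue_field v) rat].

Lemma eval_homogZ d (g : {mpoly rat[3]}) p (c : algC) : g \is d.-homog ->
  eval_algC (fun i => c * p i) g = c ^+ d * eval_algC p g.
Proof.
move=> /dhomogP gd; rewrite /eval_algC !mevalE mulr_sumr.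
apply: eq_big_seq => m; rewrite mcoeff_msupp mcoeff_map_mpoly fmorph_eq0.
rewrite -mcoeff_msupp => /gd <-; rewrite mulrCA; congr (_ * _).
rewrite [_ ^+ _](_ : _ = \prod_i c ^+ m i) -?big_split; last by rewrite prodrXr -mdegE.
apply: eq_bigr => i _ /=.
exact: exprMn.
Qed.

Lemma bad_pointZ p (c : algC) : c != 0 ->
  bad_point (fun i => c * p i) <-> bad_point p.
Proof.
move=> c0.
have cX d (g : {mpoly rat[3]}) : g \is d.-homog ->
    (eval_algC (fun i => c * p i) g == 0) = (eval_algC p g == 0).
  by move=> gd; rewrite (eval_homogZ _ _ gd) mulf_eq0 expf_eq0 (negPf c0) andbF.
have ocE : on_curve (fun i => c * p i) <-> on_curve p.
  have fd : map_Q C \is (curve_deg C).-homog.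
    have /dhomogP fd := curve_homog C; apply/dhomogP => m.
    by rewrite !mcoeff_msupp mcoeff_map_mpoly intr_eq0 -mcoeff_msupp => /fd.
  split=> -[[i pi0] e]; split; try by [exists i; rewrite mulf_eq0 (negPf c0) in pi0
    |exists i; rewrite mulf_neq0].
    by apply/eqP; rewrite -(cX _ _ fd) e.
  by apply/eqP; rewrite (cX _ _ fd) e.
have lrE : local_ring (fun i => c * p i) = local_ring p.
  apply/funext => r; apply/propext; split=> -[d [g [h [gd hd]]]].
    by rewrite (cX _ _ hd) => h0 rE; exists d, g, h.
  by move=> h0 rE; exists d, g, h; rewrite (cX _ _ hd).
have lmE : local_max (fun i => c * p i) = local_max p.
  apply/funext => r; apply/propext; split=> -[d [g [h [gd hd]]]].
    rewrite (cX _ _ hd) => h0 /eqP; rewrite (cX _ _ gd) => /eqP g0 rE.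
    by exists d, g, h.
  move=> h0 g0 rE; exists d, g, h; rewrite (cX _ _ hd); split=> //.
  by apply/eqP; rewrite (cX _ _ gd) g0.
by split=> -[]; rewrite /bad_point /singular /lies_above lrE lmE => /ocE.
Qed.

End Points.

Definition int_zero (f : {mpoly int[3]}) (x y z : int) : Prop :=
  f.@[tnth [tuple x; y; z]] = 0.

Definition bad_int_zero (C : plane_curve) (x y z : int) : Prop :=
  int_zero C x y z /\ bad_point C (fun i => (tnth [tuple x; y; z] i)%:~R).

(* Main.v *)
(* An isomorphism K = Q(T) gives coprime q_0, q_1, q_2 in Z[T], of maximal degree N, with
   X_i / X_k = q_i / q_k in K; let h_i(u, v) be the form of degree N obtained from q_i.
   The discrete valuations of K above the local ring of a point (x : y : z) with residue
   field Q are the places T = u / v of Q(T), and such a place lies above the point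
   (h_0 : h_1 : h_2)(u, v).  At a nonsingular rational point the local ring itself is such a
   valuation ring.  So the good solutions are the integer points l h(u, v) with u, v coprime
   integers and l rational.  By a Bezout identity there is R != 0 divisible by every common
   divisor of the h_i(u, v), u and v coprime; hence the good solutions are the triples
   w h(u, v) / R, where (u, v, w) runs through the set A of integer triples such that R
   divides every w h_i(u, v).

   The set A is periodic modulo R, and c a + (1 - c) b is in A for a, b in A and c idempotent
   modulo R.  As t ^ |R|! is idempotent modulo R for every integer t, the iteration of
   t ^ |R|! a + (1 - t ^ |R|!) b over representatives a of A modulo R, plus R times free
   variables, is an integral polynomial map with image A. *)
Require Import Defs.
From HB Require Import structures.
From mathcomp Require Import all_boot all_order all_algebra all_field.
From mathcomp Require Import fraction mpoly.
From mathcomp Require Import ring_quotient ring zify.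
From mathcomp.classical Require boolp.

Import Order.TTheory GRing.Theory Num.Theory.
Local Open Scope ring_scope.

Set Implicit Arguments.
Unset Strict Implicit.
Unset Printing Implicit Defensive.

(** * Binary forms with integer coefficients and congruences between their values *)

(* [q] homogenized in degree [N]. *)
Definition hform (S : comNzRingType) (N : nat) (q : {poly int}) (u v : S) : S :=
  \sum_(j < N.+1) u ^+ j * v ^+ (N - j) *~ q`_j.

Lemma rmorph_hform (S T : comNzRingType) (phi : {rmorphism S -> T}) N q u v :
  phi (hform N q u v) = hform N q (phi u) (phi v).
Proof.
by rewrite rmorph_sum; apply: eq_bigr => j _; rewrite rmorphMz rmorphM !rmorphXn.
Qed.

Lemma hform_scale (S : comNzRingType) N q (c u v : S) :
  hform N q (c * u) (c * v) = c ^+ N * hform N q u v.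
Proof.
rewrite mulr_sumr; apply: eq_bigr => j _; rewrite !exprMn mulrACA -exprD.
by rewrite subnKC ?mulrzAr // -ltnS.
Qed.

Lemma hform_horner (S : fieldType) N (q : {poly int}) (t v : S) : (size q <= N.+1)%N ->
  hform N q (t * v) v = v ^+ N * (map_poly intr q).[t].
Proof.
move=> sq; rewrite (@horner_coef_wide _ N.+1); last first.
  by apply: leq_trans sq; apply: size_poly.
rewrite mulr_sumr; apply: eq_bigr => j _.
have jN : (j <= N)%N := leq_ord j.
rewrite coef_map_id0 // exprMn -[t ^+ j * _ * _]mulrA -exprD subnKC //.
by rewrite -mulrzl mulrA mulrC.
Qed.

(** [R %| c * (a - a')] is congruence modulo the ideal of all y with R | c y. For c idempotent
    modulo R this is equality in the c-component of Z/R, which makes a factorization of R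
    unnecessary. *)
Lemma dvdz_mul_sub (c R a b a' b' : int) :
  (R %| c * (a - a'))%Z -> (R %| c * (b - b'))%Z -> (R %| c * (a * b - a' * b'))%Z.
Proof.
move=> ha hb; have -> : c * (a * b - a' * b') = c * (a - a') * b + a' * (c * (b - b')).
  by ring.
by apply: rpredD; [apply: dvdz_mulr|apply: dvdz_mull].
Qed.

Lemma dvdz_hform_sub (c R u v u' v' : int) N q :
  (R %| c * (u - u'))%Z -> (R %| c * (v - v'))%Z ->
  (R %| c * (hform N q u v - hform N q u' v'))%Z.
Proof.
have dvdX k (a a' : int) : (R %| c * (a - a'))%Z -> (R %| c * (a ^+ k - a' ^+ k))%Z.
  by move=> ha; elim: k => [|k IH]; rewrite ?subrr ?mulr0 ?dvdz0 // !exprS; apply: dvdz_mul_sub.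
move=> hu hv; rewrite -sumrB mulr_sumr; apply: rpred_sum => j _.
rewrite -mulrzBl -mulrzl mulrCA; apply: dvdz_mull; apply: dvdz_mul_sub; exact: dvdX.
Qed.

(* Pigeonhole: the powers of x modulo R are periodic from an exponent i < |R| on, with a
   period j - i at most |R|; both i <= |R|! and j - i | |R|! hold. *)
Lemma expz_idempotent (R : int) (x : int) : R != 0 ->
  (R %| x ^+ `|R|`! * (1 - x ^+ `|R|`!))%Z.
Proof.
move=> R0; set r := `|R|%N.
have r0 : (0 < r)%N by rewrite absz_gt0.
pose F (i : 'I_r.+1) : 'I_r := Ordinal (ltn_pmod `|(x ^+ i %% R)%Z|%N r0).
have /injectivePn[i [j ij Fij]] : ~~ injectiveb F.
  by apply/negP => /injectiveP/leq_card; rewrite !card_ord ltnn.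
have {Fij} : (R %| x ^+ i - x ^+ j)%Z.
  rewrite -eqz_mod_dvd; move/(congr1 val): Fij => /=.
  have lt k : (`|(x ^+ k %% R)%Z| < r)%N.
    by rewrite -ltz_nat gez0_abs ?modz_ge0 // ltz_mod.
  rewrite !modn_small //.
  by move/(congr1 Posz); rewrite !gez0_abs ?modz_ge0 // => ->.
wlog ltij : i j {ij} / (i < j)%N.
  move=> H; case: (ltngtP i j) ij => [lt _|lt _|/val_inj->]; rewrite ?eqxx //.
    exact: H lt.
  by move=> dji; rewrite -opprB rpredN in dji; apply: H dji.
move=> dij.
have ri : (i <= r`!)%N.
  have := ltn_ord j; rewrite ltnS => /(leq_trans ltij)/ltnW/leq_trans; apply.
  by apply: fact_geq.
have /dvdnP[k kE] : (j - i %| r`!)%N.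
  by apply: dvdn_fact; rewrite subn_gt0 ltij leq_subLR (leq_trans _ (leq_addl _ _)) // -ltnS.
(* The power x ^ i splits off x ^ |R|!, and 1 - x ^ (j - i) divides 1 - x ^ |R|! by a geometric
   sum. *)
have -> : x ^+ r`! * (1 - x ^+ r`!) =
   x ^+ (r`! - i) * (\sum_(l < k) x ^+ (j - i) ^+ l) * (x ^+ i - x ^+ j).
  have -> : x ^+ i - x ^+ j = x ^+ i * (1 - x ^+ (j - i)).
    by rewrite mulrBr mulr1 -exprD subnKC // ltnW.
  rewrite mulrACA -exprD subnK // kE mulnC exprM; congr (_ * _).
  by rewrite -[LHS]opprB subrX1 -mulNr opprB mulrC.
exact: dvdz_mull.
Qed.

(** * Polynomial parametrization of the admissible triples *)

(** If every [t ^+ E] is 0 or 1, this is the [a] paired with the first [t] whose power is 1. The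
    formula makes sense in any ring, hence for polynomial variables and for integers alike. *)
Fixpoint select (S : nzRingType) (E : nat) (s : seq (S * S)) : S :=
  if s is (t, a) :: s' then t ^+ E * a + (1 - t ^+ E) * select E s' else 0.

Lemma rmorph_select (S T : nzRingType) (phi : {rmorphism S -> T}) E s :
  phi (select E s) = select E [seq (phi x.1, phi x.2) | x <- s].
Proof.
elim: s => [|[t a] s IH] /=; first by rewrite rmorph0.
by rewrite rmorphD !rmorphM rmorphB rmorph1 rmorphXn IH.
Qed.

Section Parametrization.
Variables (N : nat) (q : 'I_3 -> {poly int}) (R : int).
Hypothesis R0 : R != 0.
Implicit Types a b : 'I_3 -> int.

(* The triple (u, v, w) is coded as [a] with u = a 0, v = a 1 and w = a 2. *)
Let P a i := a ord_max * hform N (q i) (a 0) (a 1).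
Let admissible a := [forall i, R %| P a i]%Z.

Let P_sub c a b : (forall j, R %| c * (a j - b j))%Z -> forall i, (R %| c * (P a i - P b i))%Z.
Proof. by move=> h i; apply: dvdz_mul_sub; [|apply: dvdz_hform_sub]. Qed.

Let admissible_mod a b : (forall j, R %| a j - b j)%Z -> admissible b -> admissible a.
Proof.
move=> ab /forallP Pb; apply/forallP => i.
rewrite -[P a i](subrK (P b i)); apply: rpredD => //.
by rewrite -[_ - _]mul1r; apply: P_sub => j; rewrite mul1r.
Qed.

Let admissible_idem c a b : (R %| c * (1 - c))%Z -> admissible a -> admissible b ->
  admissible (fun j => c * a j + (1 - c) * b j).
Proof.
move=> cc /forallP Pa /forallP Pb; apply/forallP => i; set x := fun _ => _.
(* x = a modulo the y with R | c y, and x = b modulo the y with R | (1 - c) y. *)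
have -> : P x i = c * (P x i - P a i) + (1 - c) * (P x i - P b i)
                 + (c * P a i + (1 - c) * P b i) by ring.
apply: rpredD; apply: rpredD; try exact: dvdz_mull.
  apply: P_sub => j; rewrite /x.
  have -> : c * (c * a j + (1 - c) * b j - a j) = (b j - a j) * (c * (1 - c)) by ring.
  exact: dvdz_mull.
apply: P_sub => j; rewrite /x.
have -> : (1 - c) * (c * a j + (1 - c) * b j - b j) = (a j - b j) * (c * (1 - c)) by ring.
exact: dvdz_mull.
Qed.

Let T := {ffun 'I_3 -> 'I_`|R|}.
(* A residue class outside the admissible set is represented by the admissible triple 0. *)
Let rep (s : T) i : int := if admissible (fun i => (s i)%:Z) then (s i)%:Z else 0.

Let rep_admissible s : admissible (rep s).
Proof.
rewrite /admissible; apply/forallP => i; rewrite /P /rep.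
case: ifP => [/forallP/(_ i)//|_]; by rewrite mul0r dvdz0.
Qed.

(** One selector variable for each residue class of triples modulo R, then three free variables for
    the multiples of R. At the variables this is a tuple of polynomials, at integers a map;
    [rmorph_Phi] links the two. *)
Let Phi (S : comNzRingType) (t : 'I_(#|T| + 3) -> S) i :=
  select `|R|`! [seq (t (lshift 3 j), (rep (enum_val j) i)%:~R) | j <- enum 'I_#|T|]
  + R%:~R * t (rshift #|T| i).

Let G (S : comNzRingType) (t : 'I_(#|T| + 3) -> S) i :=
  Phi t ord_max * hform N (q i) (Phi t 0) (Phi t 1).

Let rmorph_Phi (S S' : comNzRingType) (phi : {rmorphism S -> S'}) t i :
  phi (Phi t i) = Phi (phi \o t) i.
Proof.
rewrite rmorphD rmorphM rmorph_int rmorph_select -map_comp; congr (select _ _ + _).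
by apply: eq_map => j /=; rewrite rmorph_int.
Qed.

Let rmorph_G (S S' : comNzRingType) (phi : {rmorphism S -> S'}) t i :
  phi (G t i) = G (phi \o t) i.
Proof. by rewrite rmorphM rmorph_hform !rmorph_Phi. Qed.

Let Phi_admissible (t : 'I_(#|T| + 3) -> int) : admissible (Phi t).
Proof.
(* Modulo R the free variables disappear; what remains is an iterated combination of admissible
   triples by idempotents, starting from the triple 0. *)
apply: (@admissible_mod _ (fun i => select `|R|`!
    [seq (t (lshift 3 j), (rep (enum_val j) i)%:~R) | j <- enum 'I_#|T|])) => [i|].
  by rewrite /Phi addrC addKr intz dvdz_mulr.
elim: (enum _) => [|j s IH] /=.
  by apply/forallP => i; rewrite /P mul0r dvdz0.
apply: admissible_idem => //; first exact: expz_idempotent.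
by under [X in admissible X]boolp.funext => i do rewrite intz.
Qed.

Let Phi_surj a : admissible a -> exists t, forall i, Phi t i = a i.
Proof.
move=> Pa; have r0 : (0 < `|R|)%N by rewrite absz_gt0.
have lt i : (`|(a i %% R)%Z| < `|R|)%N.
  by rewrite -ltz_nat gez0_abs ?modz_ge0 // ltz_mod.
pose s : T := [ffun i => Ordinal (lt i)].
have sE i : (s i)%:Z = (a i %% R)%Z by rewrite ffunE /= gez0_abs ?modz_ge0.
have repE i : rep s i = (a i %% R)%Z.
  rewrite /rep ifT ?sE //; apply: admissible_mod Pa => j.
  by rewrite sE {2}(divz_eq (a j) R) opprD addrCA subrr addr0 rpredN dvdz_mull.
(* The selector of the class of [a] is 1 and the others are 0, which the positive exponent |R|! does
   not change; the free variables are the quotients by R. *)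
exists (fun j => match split j with inl j => (j == enum_rank s)%:Z | inr i => (a i %/ R)%Z end).
move=> i; rewrite /Phi (unsplitK (inr i)) intz [RHS](divz_eq _ R) addrC mulrC; congr (_ + _).
rewrite -repE.
have : enum_rank s \in enum 'I_#|T| by rewrite mem_enum.
elim: (enum _) => //= j l IH; rewrite inE (unsplitK (inl j)).
case: eqVneq => [<- _|_ /= /IH ->].
  by rewrite expr1n subrr mul0r mul1r addr0 enum_rankK intz.
by rewrite expr0n gtn_eqF ?fact_gt0 // mul0r add0r subr0 mul1r.
Qed.

(** All values of [Phi] at integers are admissible, so R divides those of [G]: the quotient of [G]
    by R is integer-valued, though its coefficients need not be integers. *)
Lemma parametrization : exists (m : nat) (g : 'I_3 -> {mpoly rat[m]}),
  (forall i, integer_valued (g i)) /\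
  forall x : 'I_3 -> int,
    (exists u v w : int, forall i, R * x i = w * hform N (q i) u v) <->
    (exists t : 'I_m -> int, forall i, (g i).@[fun j => (t j)%:~R] = (x i)%:~R).
Proof.
exists (#|T| + 3)%N, (fun i => R%:~R^-1 *: G (fun j => 'X_j) i).
have RQ : R%:~R != 0 :> rat by rewrite intr_eq0.
have gE (t : 'I_(#|T| + 3) -> int) i :
    (R%:~R^-1 *: G (fun j => 'X_j) i : {mpoly rat[_]}).@[fun j => (t j)%:~R] =
    R%:~R^-1 * (G t i)%:~R.
  rewrite mevalZ rmorph_G [in RHS]rmorph_G; congr (_ * G _ _).
  by apply: boolp.funext => j /=; rewrite mevalXU.
have GE t i : exists z, G t i = R * z.
  have /forallP/(_ i)/dvdzP[z e] := Phi_admissible t.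
  by exists z; rewrite mulrC -e.
split=> [i t|x].
  by rewrite gE; have [z ->] := GE t i; rewrite intrM mulKf // intr_int.
split=> [[u [v [w e]]]|[t e]].
  have [|t tE] := @Phi_surj (fun i => if i == ord_max then w else if i == 0 then u else v).
    by apply/forallP => i; rewrite /P /= -e dvdz_mulr.
  by exists t => i; rewrite gE /G !tE /= -e intrM mulKf.
exists (Phi t 0), (Phi t 1), (Phi t ord_max) => i.
apply: (@intr_inj rat); rewrite intrM -e gE mulVKf //.
Qed.

End Parametrization.

(** * Families of integer polynomials without a common zero *)

(** The [q i] generate the unit ideal of Q[T]; R is what clearing the denominators of a Bezout
    identity leaves. *)
Definition unimodular n (q : 'I_n -> {poly int}) : Prop :=
  exists (a : 'I_n -> {poly int}) (R : int), R != 0 /\ \sum_i a i * q i = R%:P.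

Lemma ord_choice n (T : Type) (P : 'I_n -> T -> Prop) :
  (forall i, exists x, P i x) -> exists f, forall i, P i (f i).
Proof. exact: (@fin_all_exists _ (fun=> T)). Qed.

Lemma common_denominator n (A : 'I_n -> {poly rat}) :
  exists (d : int) (a : 'I_n -> {poly int}), d != 0 /\
    forall i, d%:~R *: A i = map_poly intr (a i).
Proof.
have /ord_choice[x xP] i : exists x : {poly int} * int,
    x.2 != 0 /\ A i = x.2%:~R^-1 *: map_poly intr x.1.
  by have [q [d d0 e]] := rat_poly_scale (A i); exists (q, d).
exists (\prod_i (x i).2), (fun i => (\prod_(j | j != i) (x j).2) *: (x i).1); split.
  by apply/prodf_neq0 => i _; case: (xP i).
move=> i; have [di AE] := xP i.
rewrite map_polyZ /= {1}AE scalerA (bigD1 i) //= intrM; congr (_ *: _).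
by rewrite mulrAC mulfV ?mul1r // intr_eq0.
Qed.

Lemma gcdp_family (F : fieldType) n (c : 'I_n -> {poly F}) :
  exists (g : {poly F}) (A : 'I_n -> {poly F}),
    (forall i, g %| c i) /\ \sum_i A i * c i = g.
Proof.
elim: n c => [|n IH] c; first by exists 0, (fun _ => 0); rewrite big_ord0; split=> // -[].
have [g [A [gc Ag]]] := IH (fun i => c (lift ord0 i)).
have [[u v] /= /andP[ug gu]] := Bezoutp (c ord0) g.
exists (u * c ord0 + v * g), (fun i => if unlift ord0 i is Some j then v * A j else u).
split=> [i|].
  apply: dvdp_trans ug _; have [j ->|->] := unliftP ord0 i; last exact: dvdp_gcdl.
  exact: dvdp_trans (dvdp_gcdr _ _) (gc j).
rewrite big_ord_recl unlift_none -Ag mulr_sumr; congr (_ + _).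
by apply: eq_bigr => i _; rewrite liftK mulrA.
Qed.

Lemma unimodular_rat n (q : 'I_n -> {poly int}) (A : 'I_n -> {poly rat}) (c : rat) :
  c != 0 -> \sum_i A i * map_poly intr (q i) = c%:P -> unimodular q.
Proof.
move=> c0 e; have [d [a [d0 aE]]] := common_denominator (fun i => c^-1 *: A i).
exists a, d; split=> //; apply: (@map_inj_poly _ rat intr) => //; first exact: intr_inj.
rewrite rmorph_sum map_polyC /=.
under eq_bigr => i _ do rewrite rmorphM /= -aE -!scalerAl.
by rewrite -!scaler_sumr e -!mul_polyC -!polyCM mulVf // mulr1.
Qed.

(** The gcd over Q is divided out and the denominators of the quotients are cleared; [g] absorbs the
    resulting scalar. This normalizes homogeneous coordinates over Q(T). *)
Lemma unimodular_part n (c : 'I_n -> {poly rat}) i0 : c i0 != 0 ->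
  exists (g : {poly rat}) (q : 'I_n -> {poly int}),
    [/\ g != 0, forall i, c i = g * map_poly intr (q i) & unimodular q].
Proof.
move=> c0; have [g [A [gc Ag]]] := gcdp_family c.
have g0 : g != 0 by apply: contraTneq (gc i0) => ->; rewrite dvd0p.
have [d [q [d0 qE]]] := common_denominator (fun i => c i %/ g).
have dQ : d%:~R != 0 :> rat by rewrite intr_eq0.
exists (d%:~R^-1 *: g), q; split.
- by rewrite scaler_eq0 invr_eq0 negb_or dQ.
- by move=> i; rewrite -qE -scalerAl -scalerAr scalerA mulVf // scale1r mulrC divpK.
apply: (@unimodular_rat _ _ A d%:~R) => //; apply: (mulIf g0).
rewrite mulr_suml mul_polyC -{2}Ag scaler_sumr; apply: eq_bigr => i _.
by rewrite -qE -scalerAr -scalerAl -mulrA divpK.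
Qed.

(** Homogenization of the Bezout identity: put T = u / v in the field of fractions and multiply by v
    ^ (M + N). *)
Lemma bezout_hform (S : idomainType) n M N (a q : 'I_n -> {poly int}) (R : int) (u v : S) :
  (forall i, size (a i) <= M.+1)%N -> (forall i, size (q i) <= N.+1)%N ->
  \sum_i a i * q i = R%:P -> v != 0 ->
  \sum_i hform M (a i) u v * hform N (q i) u v = v ^+ (M + N) *~ R.
Proof.
move=> sa sq e v0; apply/eqP; rewrite -tofrac_eq; apply/eqP.
have V0 : FracField.tofrac v != 0 by rewrite tofrac_eq0.
rewrite rmorph_sum rmorphMz rmorphXn /=.
have uE : FracField.tofrac u = FracField.tofrac u / FracField.tofrac v * FracField.tofrac v.
  by rewrite divfK.
under eq_bigr => i _.
  rewrite rmorphM /= !rmorph_hform /= uE !hform_horner //.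
  rewrite mulrACA -exprD -hornerM -rmorphM /=; over.
rewrite -mulr_sumr -horner_sum -rmorph_sum e /= map_polyC hornerC /=.
by rewrite mulrzr.
Qed.

(** This is T ^ N q(1 / T) for q of degree at most N: the same binary form, dehomogenized at the
    other variable. *)
Definition hrev N (q : {poly int}) : {poly int} := \poly_(i < N.+1) q`_(N - i).

Lemma size_hrev N q : (size (hrev N q) <= N.+1)%N.
Proof. exact: size_poly. Qed.

Lemma hrevK N (q : {poly int}) : (size q <= N.+1)%N -> hrev N (hrev N q) = q.
Proof.
move=> sq; apply/polyP => i; rewrite !coef_poly !ltnS leq_subr.
by case: leqP => iN; [rewrite subKn | rewrite nth_default // (leq_trans sq)].
Qed.

Lemma hrev_eq0 N (q : {poly int}) : (size q <= N.+1)%N -> (hrev N q == 0) = (q == 0).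
Proof.
have h0 : hrev N 0 = 0 by apply/polyP => i; rewrite coef_poly !coef0 if_same.
move=> sq; apply/eqP/eqP => [e|-> //]; by rewrite -(hrevK sq) e h0.
Qed.

Lemma map_intr_eq0 (q : {poly int}) : (map_poly intr q == 0 :> {poly rat}) = (q == 0).
Proof.
rewrite -[0 in LHS](rmorph0 (map_poly (intr : int -> rat))).
by apply: inj_eq; apply: map_inj_poly => //; apply: intr_inj.
Qed.

Lemma hrev_hform N q : hrev N q = hform N q 1 'X.
Proof.
rewrite /hrev poly_def (reindex_inj rev_ord_inj); apply: eq_bigr => j _ /=.
by rewrite subSS subKn ?leq_ord // expr1n mul1r -mul_polyC -[q`_j in LHS]intz rmorph_int mulrzl.
Qed.

Lemma hform_hrev (S : comNzRingType) N q (u v : S) : hform N (hrev N q) v u = hform N q u v.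
Proof.
rewrite /hform (reindex_inj rev_ord_inj); apply: eq_bigr => j _ /=.
by rewrite subSS coef_poly ltnS leq_subr subKn ?leq_ord // mulrC.
Qed.

(** The hypotheses say that the forms have no common zero on the projective line: [unimodular]
    excludes those with v != 0, the coefficient of degree [N] excludes (1 : 0). This condition is
    symmetric in u and v. *)
Lemma unimodular_hrev n N (q : 'I_n -> {poly int}) i0 :
  (forall i, size (q i) <= N.+1)%N -> (q i0)`_N != 0 -> unimodular q ->
  unimodular (fun i => hrev N (q i)).
Proof.
move=> sq qN [a [R [R0 e]]].
pose M := (\max_i size (a i))%N.
have sa i : (size (a i) <= M.+1)%N by apply/leqW/leq_bigmax.
(* At u = 1 and v = T the homogenized identity puts R T ^ (M + N) in the ideal of the reversed
   polynomials. *)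
have := bezout_hform 1 sa sq e (negbT (polyX_eq0 int)).
have [g [A [gq Ag]]] := gcdp_family (fun i => map_poly intr (hrev N (q i)) : {poly rat}).
under eq_bigr => i _ do rewrite -!hrev_hform.
move/(congr1 (map_poly (intr : int -> rat))).
rewrite rmorph_sum rmorphMz rmorphXn /= map_polyX => e1.
(* The gcd g of the reversed polynomials divides a power of 'X, but g(0) != 0. *)
have gX : g %| 'X^(M + N).
  rewrite -[X in _ %| X]scale1r -(mulVf (_ : R%:~R != 0 :> rat)) ?intr_eq0 //.
  rewrite -scalerA dvdpZr ?invr_eq0 ?intr_eq0 // scaler_int -e1.
  apply: (big_ind (fun p => g %| p)) => [||i _]; rewrite ?dvdp0 //.
    exact: dvdp_add.
  by rewrite rmorphM /=; apply: dvdp_mull; apply: gq.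
have g0 : ~~ root g 0.
  apply: contraNN qN => g0; have := dvdp_trans (_ : 'X - 0%:P %| g) (gq i0).
  rewrite -!root_factor_theorem => /(_ g0).
  by rewrite /root horner_coef0 coef_map coef_poly subn0 intr_eq0.
have : coprimep g g.
  apply: coprimep_dvdl gX _; apply: coprimep_expr.
  by rewrite -['X]subr0 -[0]/(0%:P) coprimep_XsubC.
rewrite coprimepp => /eqP/eq_leq/size1_polyC gC.
apply: (unimodular_rat (A := A) (c := g`_0)); last by rewrite -gC.
by rewrite -horner_coef0.
Qed.

Lemma unimodular_horner n (q : 'I_n -> {poly int}) (t : rat) : unimodular q ->
  exists i, (map_poly intr (q i)).[t] != 0.
Proof.
move=> [a [R [R0 e]]]; apply/existsP; apply: contraNT R0 => /existsPn q0.
rewrite -(@intr_eq0 rat) -(hornerC _%:~R t) -map_polyC -e rmorph_sum horner_sum big1 // => i _.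
by rewrite rmorphM hornerM (eqP (negPn (q0 i))) mulr0.
Qed.

Lemma unimodular_dvd n N (q : 'I_n -> {poly int}) :
  (forall i, size (q i) <= N.+1)%N -> unimodular q ->
  exists (R : int) k, R != 0 /\ forall u v b : int,
    (forall i, b %| hform N (q i) u v)%Z -> (b %| R * v ^+ k)%Z.
Proof.
move=> sq [a [R [R0 e]]]; pose M := (\max_i size (a i))%N.
have sa i : (size (a i) <= M.+1)%N by apply/leqW/leq_bigmax.
(* The extra 1 keeps the exponent positive, so that v = 0 leaves only the divisibility of 0. *)
exists R, (M + N).+1; split=> // u v b bh.
have [->|v0] := eqVneq v 0; first by rewrite exprS mul0r mulr0 dvdz0.
rewrite exprSr mulrA; apply: dvdz_mulr.
rewrite mulrC -mulrzz -(bezout_hform u sa sq e v0).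
by apply: rpred_sum => i _; apply: dvdz_mull.
Qed.

(** The denominator of [l] is coprime to its numerator, hence divides every form value. By the
    Bezout identities of the forms and of their reversals it divides R v ^ k and R' u ^ k', and so R
    R', as u and v are coprime. *)
Lemma bounded_denominator n N (q : 'I_n -> {poly int}) i0 :
  (forall i, size (q i) <= N.+1)%N -> (q i0)`_N != 0 -> unimodular q ->
  exists R : int, R != 0 /\ forall (x : 'I_n -> int) (u v : int) (l : rat),
    coprimez u v -> (forall i, (x i)%:~R = l * (hform N (q i) u v)%:~R) ->
    exists w, forall i, R * x i = w * hform N (q i) u v.
Proof.
move=> sq qN qU; have [R [k [R0 RP]]] := unimodular_dvd sq qU.
have qrU := unimodular_hrev sq qN qU.
have [R' [k' [R'0 RP']]] := unimodular_dvd (fun i => size_hrev N (q i)) qrU.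
exists (R * R'); split=> [|x u v l uv xE]; first exact: mulf_neq0.
set b := denq l; set a := numq l.
have b0 : b != 0 by apply: denq_neq0.
have bx i : b * x i = a * hform N (q i) u v.
  apply: (@intr_inj rat); rewrite !intrM xE -{1}(divq_num_den l) -/a -/b.
  by rewrite mulrA [_ / _]mulrC mulVKf // intr_eq0.
have bh i : (b %| hform N (q i) u v)%Z.
  rewrite -(@Gauss_dvdzr _ a) -?bx ?dvdz_mulr //.
  by rewrite coprimez_sym coprimezE; apply: coprime_num_den.
have : coprimez (v ^+ k) (u ^+ k').
  by rewrite coprimezE !abszX coprimeXl ?coprimeXr // coprime_sym.
have bu : (b %| R' * u ^+ k')%Z by apply: (RP' v) => i; rewrite hform_hrev.
have bv := RP u v b bh.
move=> /coprimezP[[s t] /= st].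
have /dvdzP[c cE] : (b %| R * R')%Z.
  have -> : R * R' = R * v ^+ k * (s * R') + R' * u ^+ k' * (t * R).
    by rewrite -[LHS]mulr1 -st; ring.
  by apply: rpredD; apply: dvdz_mulr.
by exists (c * a) => i; rewrite cE -mulrA bx mulrA.
Qed.

(** * Auxiliary facts on ring morphisms, fractions and homogeneity *)

Lemma bijective_rmorphism_inv (R S : nzRingType) (f : {rmorphism R -> S}) :
  bijective f -> exists2 g : {rmorphism S -> R}, cancel f g & cancel g f.
Proof.
move=> [g fK gK].
pose gZ := GRing.isZmodMorphism.Build S R g (can2_zmod_morphism fK gK).
pose gM := GRing.isMonoidMorphism.Build S R g (can2_monoid_morphism fK gK).
pose G : {rmorphism S -> R} := HB.pack g gZ gM.
by exists G.
Qed.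

Lemma eq_rat_rmorphism (F : fieldType) (f g : {rmorphism rat -> F}) : f =1 g.
Proof.
move=> x; rewrite -(divq_num_den x) !fmorph_div !rmorph_int.
by [].
Qed.

Lemma fractionP (R : idomainType) (x : {fraction R}) :
  exists a b : R, b != 0 /\ x = FracField.tofrac a / FracField.tofrac b.
Proof.
elim/quotW: x => y; exists y.1, y.2; have y20 := denom_ratioP y; split=> //.
have Y0 : FracField.tofrac y.2 != 0 by rewrite tofrac_eq0.
apply: (mulIf Y0); rewrite divfK //.
rewrite -[LHS]/(FracField.mul _ _) !piE; apply/eqmodP => /=.
by rewrite FracField.equivfE /FracField.mulf !numden_Ratio ?mulf_neq0 ?oner_eq0 // !mulr1 mulrC.
Qed.

Lemma map_Q_homog n d (f : {mpoly int[n]}) : f \is d.-homog -> map_Q f \is d.-homog.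
Proof.
move=> /dhomogP fd; apply/dhomogP => m.
by rewrite !mcoeff_msupp mcoeff_map_mpoly intr_eq0 -mcoeff_msupp => /fd.
Qed.

(** * The function field of the curve and its generators over Q *)

Section CoordinateField.
Variable C : plane_curve.
Implicit Types g h : {mpoly rat[3]}.

Definition coord_frac g : {fraction (coord_ring C)} := FracField.tofrac (coord_class C g).

Fact coord_frac_zmod_morphism : zmod_morphism coord_frac.
Proof. by move=> g h; rewrite /coord_frac coord_classD coord_classN rmorphB. Qed.

Fact coord_frac_monoid_morphism : monoid_morphism coord_frac.
Proof.
by split=> [|g h]; rewrite /coord_frac ?coord_class1 ?rmorph1 // coord_classM rmorphM.
Qed.

HB.instance Definition _ := GRing.isZmodMorphism.Build {mpoly rat[3]} _ coord_frac
  coord_frac_zmod_morphism.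
HB.instance Definition _ := GRing.isMonoidMorphism.Build {mpoly rat[3]} _ coord_frac
  coord_frac_monoid_morphism.

Lemma coord_frac_eq0 g : (coord_frac g == 0) = (g \in curve_ideal C).
Proof. by rewrite tofrac_eq0 coord_class_eq0. Qed.

Lemma coord_frac_curve : coord_frac (map_Q C) = 0.
Proof. by apply/eqP; rewrite coord_frac_eq0; apply/boolp.asboolP; exists 1; rewrite mul1r. Qed.

Lemma ff_val_eq0 (r : function_field C) : (ff_val r == 0) = (r == 0).
Proof. exact: (fmorph_eq0 val). Qed.

Lemma ff_valM (r s : function_field C) : ff_val (r * s) = ff_val r * ff_val s.
Proof. by have /= -> : val (r * s) = val r * val s by rewrite rmorphM. Qed.

Lemma ff_valB (r s : function_field C) : ff_val (r - s) = ff_val r - ff_val s.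
Proof. by have /= -> : val (r - s) = val r - val s by rewrite rmorphB. Qed.

Lemma ff_valX (r : function_field C) k : ff_val (r ^+ k) = ff_val r ^+ k.
Proof. exact: (rmorphXn val). Qed.

Lemma function_field_elt d g h : g \is d.-homog -> h \is d.-homog -> h \notin curve_ideal C ->
  exists r : function_field C, ff_val r = coord_frac g / coord_frac h.
Proof.
move=> gd hd h0.
have rP : hfrac C g h \in @homog_frac C by apply/boolp.asboolP; exists d, g, h.
by exists (FunctionField rP).
Qed.

(** If X_0 = a f, then a is constant because f is not, so f vanishes where X_0 does; at (0 : 1 : 0)
    this contradicts X_1 = b f. *)
Lemma mpolyX_notin_curve_ideal : exists i : 'I_3, 'X_i \notin curve_ideal C.
Proof.
apply/existsP/contraT => /existsPn XP.
have XQ i : exists a, 'X_i = a * map_Q C :> {mpoly rat[3]}.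
  by apply/boolp.asboolP; have := XP i; rewrite negbK.
have [a aE] := XQ 0; have [b bE] := XQ 1.
have f1 : (1 < msize (map_Q C))%N.
  have [f0 _ _] := curve_prime C.
  have := map_Q_homog (curve_homog C); move=> /[dup] /dhomog_msize h /(dhomog_uniq f0)/(_ h).
  by have := curve_deg_gt0 C; case: (msize _) => [|[|k]] //= + e; rewrite e.
have : msize a = 1%N.
  have X0 : 'X_0 != 0 :> {mpoly rat[3]} by rewrite -msize_poly_eq0 msizeX mdeg1.
  have a0 : a != 0 by apply: contraNneq X0 => a0; rewrite aE a0 mul0r.
  have c0 : map_Q C != 0 by apply: contraNneq X0 => c0; rewrite aE c0 mulr0.
  have := congr1 (fun p => msize p) aE; rewrite msizeM // msizeX mdeg1.
  have : (0 < msize a)%N by rewrite lt0n msize_poly_eq0.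
  by move: (mmeasure mdeg a) (mmeasure mdeg (map_Q C)) f1 => k l; lia.
move=> /eqP sa; have [c c0 ac] := elimT (msize_poly1P _) sa.
have := congr1 (meval (fun i => (i == 1 :> 'I_3)%:R)) aE.
have := congr1 (meval (fun i => (i == 1 :> 'I_3)%:R)) bE.
rewrite !mevalM !mevalXU ac mevalC /= => e1 /esym/eqP.
rewrite mulf_eq0 (negPf c0) /= => /eqP e2; move/eqP: e1.
by rewrite e2 mulr0 oner_eq0.
Qed.

Definition poly_form (b : 'I_3 -> {poly rat}) : {mpoly rat[3]} -> {poly rat} := mmap polyC b.

HB.instance Definition _ b := GRing.RMorphism.on (poly_form b).

Lemma horner_poly_form b g t : (poly_form b g).[t] = g.@[fun i => (b i).[t]].
Proof.
rewrite /poly_form /mmap mevalE horner_sum; apply: eq_bigr => m _.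
rewrite hornerM hornerC /mmap1 horner_prod; congr (_ * _).
by apply: eq_bigr => i _; rewrite horner_exp.
Qed.

(* [j 'X] generates the function field over Q, and in terms of it the point (b_0 : b_1 : b_2) is
   the generic point of the curve; [mu] is the factor between [b] and the coordinates. *)
Definition chart (j : {rmorphism {poly rat} -> function_field C}) (b : 'I_3 -> {poly rat}) :=
  [/\ injective j,
      forall r, exists N D, D != 0 /\ r = j N / j D &
      exists2 mu, mu != 0 & forall i, ff_val (j (b i)) = mu * coord_frac 'X_i].

(** A form of degree d picks up the factor mu ^ d, which cancels in quotients of two forms of the
    same degree. *)
Lemma chart_poly_form j b : chart j b -> exists2 mu, mu != 0 &
  forall d g, g \is d.-homog -> ff_val (j (poly_form b g)) = mu ^+ d * coord_frac g.
Proof.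
move=> [_ _ [mu mu0 bE]]; exists mu => // d g /dhomogP gd.
rewrite -[ff_val _]/((val \o j) _) /poly_form /mmap rmorph_sum /=.
rewrite [in RHS](mpolyE g) rmorph_sum mulr_sumr; apply: eq_big_seq => m /gd dm.
rewrite -mul_mpolyC !rmorphM /= mulrCA; congr (_ * _).
  exact: (eq_rat_rmorphism ((val \o j) \o polyC) (coord_frac \o (@mpolyC 3 rat))).
rewrite -[LHS]/((val \o j) _) /mmap1 [X in coord_frac X]mpolyXE_id !rmorph_prod /=.
rewrite (_ : mu ^+ d = \prod_i mu ^+ m i) -?big_split; last first.
  by rewrite prodrXr -mdegE -dm.
apply: eq_bigr => i _ /=.
rewrite (rmorphXn coord_frac) -exprMn -bE; exact: (rmorphXn (val \o j)).
Qed.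

Lemma chart_curve j b : chart j b -> poly_form b (map_Q C) = 0.
Proof.
move=> ch; have [mu mu0 muE] := chart_poly_form ch; case: ch => j_inj _ _.
apply: j_inj; rewrite rmorph0; apply: val_inj; rewrite rmorph0 /=.
by rewrite (muE _ _ (map_Q_homog (curve_homog C))) coord_frac_curve mulr0.
Qed.

Lemma chart_hfrac j b d g h r : chart j b -> g \is d.-homog -> h \is d.-homog ->
  ff_val r = hfrac C g h -> r = j (poly_form b g) / j (poly_form b h).
Proof.
move=> ch gd hd rE; have [mu mu0 muE] := chart_poly_form ch.
apply: val_inj; rewrite fmorph_div /= rE (muE d g) // (muE d h) //.
by rewrite invfM mulrACA divff ?expf_neq0 // mul1r.
Qed.

Lemma chart_exists : ring_isom (function_field C) {fraction {poly rat}} ->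
  exists (j : {rmorphism {poly rat} -> function_field C}) (q : 'I_3 -> {poly int}),
    chart j (fun i => map_poly intr (q i)) /\ unimodular q.
Proof.
move=> [phi /bijective_rmorphism_inv[psi phiK psiK]].
pose j : {rmorphism {poly rat} -> function_field C} := psi \o (@FracField.tofrac {poly rat}).
have j_inj : injective j.
  by move=> a b /(can_inj psiK)/eqP; rewrite tofrac_eq => /eqP.
have j_gen r : exists N D, D != 0 /\ r = j N / j D.
  have [a [b [b0 e]]] := fractionP (phi r); exists a, b; split=> //.
  by rewrite -(phiK r) e fmorph_div.
clearbody j; have j0 a : (j a == 0) = (a == 0) by rewrite -(inj_eq j_inj) rmorph0.
have [i0 X0] := mpolyX_notin_curve_ideal.
have cX0 : coord_frac 'X_i0 != 0 by rewrite coord_frac_eq0.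
have hX i : ('X_i : {mpoly rat[3]}) \is 1.-homog.
  by rewrite dhomogX; apply/eqP; exact: mdeg1.
have /ord_choice[e eE] i : exists e : function_field C,
    ff_val e = coord_frac 'X_i / coord_frac 'X_i0.
  by apply: function_field_elt (hX _) (hX _) X0.
have /ord_choice[N NP] i : exists N : {poly rat} * {poly rat},
    N.2 != 0 /\ e i = j N.1 / j N.2.
  by have [a [b h]] := j_gen (e i); exists (a, b).
(* [D] is a common denominator of the ratios X_i / X_i0 as functions of T, and the [c i] are the
   numerators. *)
pose D := \prod_i (N i).2; pose c i := (N i).1 * \prod_(k | k != i) (N k).2.
have D0 : D != 0 by apply/prodf_neq0 => i _; case: (NP i).
have cE i : j (c i) = e i * j D.
  have [n0 ->] := NP i; rewrite /D (bigD1 i) //= !rmorphM mulrA.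
  by rewrite divfK ?j0.
have e0 : e i0 = 1 by apply: val_inj; rewrite rmorph1 /= eE divff.
have c0 : c i0 != 0 by rewrite -j0 cE e0 mul1r j0.
have [g [q [g0 cq qU]]] := unimodular_part c0.
exists j, q; split=> //; split=> //.
(* The factor comes from c_i = g q_i and j(c_i) = (X_i / X_i0) j(D). *)
exists (ff_val (j D / j g) / coord_frac 'X_i0).
  apply: mulf_neq0; last by rewrite invr_eq0.
  by rewrite ff_val_eq0 mulf_neq0 ?invr_eq0 ?j0.
move=> i; rewrite mulrAC -mulrA -eE.
rewrite -ff_valM; congr ff_val.
by rewrite mulrAC [_ * e i]mulrC -cE cq rmorphM mulrAC divff ?mul1r ?j0.
Qed.

Lemma poly_hform N (q : {poly int}) : (size q <= N.+1)%N ->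
  map_poly intr q = hform N q 'X 1 :> {poly rat}.
Proof.
move=> sq; rewrite -{1}(hrevK sq) hrev_hform hform_hrev rmorph_hform /= map_polyX.
by rewrite rmorph1.
Qed.

(** The identity q(T) = T ^ N q_rev(1 / T), where [j'] sends the variable to the inverse of its
    image under [j]. *)
Lemma rmorph_hrev (K : fieldType) (j j' : {rmorphism {poly rat} -> K}) N (q : {poly int}) :
  j 'X * j' 'X = 1 -> (size q <= N.+1)%N ->
  j (map_poly intr q) = j 'X ^+ N * j' (map_poly intr (hrev N q)).
Proof.
move=> jj sq; rewrite hrev_hform !rmorph_hform /= map_polyX (poly_hform sq).
by rewrite !rmorph_hform !rmorph1 -hform_scale jj mulr1.
Qed.

(* Replacing T by 1 / T reverses the polynomials; this chart sees the place at infinity. *)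
Lemma chart_inv j N (q : 'I_3 -> {poly int}) : (forall i, (size (q i) <= N.+1)%N) ->
  chart j (fun i => map_poly intr (q i)) ->
  exists j' : {rmorphism {poly rat} -> function_field C},
    j 'X * j' 'X = 1 /\ chart j' (fun i => map_poly intr (hrev N (q i))).
Proof.
move=> sq [j_inj j_gen [mu mu0 bE]].
have j0 a : (j a == 0) = (a == 0) by rewrite -(inj_eq j_inj) rmorph0.
have X0 : j 'X != 0 by rewrite j0 polyX_eq0.
have comm : commr_rmorph (j \o polyC) (j 'X)^-1 by move=> x; apply: mulrC.
pose j' : {rmorphism {poly rat} -> function_field C} := horner_morph comm.
have jj : j 'X * j' 'X = 1 
  by rewrite (horner_morphX comm : j' 'X = _) mulfV.
clearbody j'.
have jj' : j' 'X * j 'X = 1 by rewrite mulrC.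
have X'0 : j' 'X != 0 by apply: contra_eq_neq jj => ->; rewrite mulr0 eq_sym oner_neq0.
exists j'; split=> //; split.
(* Up to a denominator p is an integer polynomial; its image under [j'] is a power of 1 / T times
   the nonzero image under [j] of its reversal. *)
- apply: raddf_inj => p /eqP; apply: contraTeq => p0.
  have [d [a [d0 aE]]] := common_denominator (fun _ : 'I_1 => p).
  have := aE 0; set a0 := a 0 => a0E.
  have sa : (size a0 <= (size a0).+1)%N by [].
  have : j' (map_poly intr a0) != 0.
    rewrite (rmorph_hrev jj' sa); apply: mulf_neq0; first exact: expf_neq0.
    rewrite j0 map_intr_eq0 (hrev_eq0 sa) -map_intr_eq0.
    by rewrite -a0E scaler_eq0 negb_or intr_eq0 d0.
  by rewrite -a0E -mul_polyC rmorphM mulf_eq0 negb_or => /andP[].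
(* Numerator and denominator are reversed in one common degree [n], so that the powers of T
   cancel. *)
- move=> r; have [P [D [D0 ->]]] := j_gen r.
  have [d [a [d0 aE]]] := common_denominator (fun i : 'I_2 => if i == 0 then P else D).
  have a0E : d%:~R *: P = map_poly intr (a 0) := aE 0.
  have a1E : d%:~R *: D = map_poly intr (a 1) := aE 1.
  have dj : j (d%:~R)%:P != 0 by rewrite j0 polyC_eq0 intr_eq0.
  pose n := maxn (size (a 0)) (size (a 1)).
  have s0 : (size (a 0%R) <= n.+1)%N by rewrite leqW // leq_maxl.
  have s1 : (size (a 1%R) <= n.+1)%N by rewrite leqW // leq_maxr.
  have D'0 : j (map_poly intr (a 1)) != 0.
    rewrite -a1E -mul_polyC rmorphM; apply: mulf_neq0; first exact: dj.
    by rewrite j0.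
  exists (map_poly intr (hrev n (a 0))), (map_poly intr (hrev n (a 1))); split.
    apply: contraNneq D'0 => e; rewrite (rmorph_hrev jj s1) e rmorph0 mulr0 //.
  have -> : j P / j D = j (map_poly intr (a 0)) / j (map_poly intr (a 1)).
    by rewrite -a0E -a1E -!mul_polyC !rmorphM invfM mulrACA (divff dj) mul1r.
  rewrite (rmorph_hrev jj s0) (rmorph_hrev jj s1) invfM mulrACA.
  by rewrite (divff (expf_neq0 n X0)) mul1r.
exists (mu * ff_val (j' 'X) ^+ N).
  by apply: (mulf_neq0 mu0); apply: expf_neq0; rewrite ff_val_eq0.
move=> i; have jE : j' (map_poly intr (hrev N (q i))) = j (map_poly intr (q i)) * j' 'X ^+ N.
  by rewrite (rmorph_hrev jj (sq i)) mulrAC -exprMn jj expr1n mul1r.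
by rewrite jE ff_valM ff_valX bE mulrAC.
Qed.

End CoordinateField.

(** * The discrete valuation of a rational function field at T = t *)

Section PlaceOfRationalPoint.
Variables (F K : fieldType) (j : {rmorphism {poly F} -> K}) (t : F).
Hypothesis j_inj : injective j.
Hypothesis j_gen : forall r, exists N D, D != 0 /\ r = j N / j D.

Let pi : K := j ('X - t%:P).

(** The units of the local ring at T = t; each nonzero element of K is a power of [pi] times one of
    them. *)
Let U (x : K) := exists N D : {poly F}, [/\ N.[t] != 0, D.[t] != 0 & x = j N / j D].

Let j0 p : (j p == 0) = (p == 0).
Proof. by rewrite -(inj_eq j_inj) rmorph0. Qed.

Let jn0 p : p.[t] != 0 -> j p != 0.
Proof. by move=> pt; rewrite j0; apply: contraNneq pt => ->; rewrite horner0. Qed.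

Let pi0 : pi != 0.
Proof. by rewrite j0 polyXsubC_eq0. Qed.

Let UM x y : U x -> U y -> U (x * y).
Proof.
move=> [N [D [N0 D0 ->]]] [N' [D' [N'0 D'0 ->]]]; exists (N * N'), (D * D').
by rewrite !hornerM !mulf_neq0 // mulf_div !rmorphM.
Qed.

Let UV x : U x -> U x^-1.
Proof. by move=> [N [D [N0 D0 ->]]]; exists D, N; rewrite invf_div. Qed.

(** The condition x != 0 stands below the quantifier so that choice yields a total order function,
    arbitrary at 0. *)
Let order_decomp x : exists k, x != 0 -> U (x / pi ^ k).
Proof.
have [->|x0] := eqVneq x 0; first by exists 0.
have dec p : p != 0 -> exists k p1, p1.[t] != 0 /\ p = p1 * ('X - t%:P) ^+ k.
  by move=> p0; have [k [q]] := multiplicity_XsubC p t; rewrite p0 => /= qt e; exists k, q.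
have [N [D [D0 e]]] := j_gen x.
have N0 : N != 0 by apply: contraNneq x0 => N0; rewrite e N0 rmorph0 mul0r.
have [k [N1 [N1t NE]]] := dec N N0; have [l [D1 [D1t DE]]] := dec D D0.
exists (k%:Z - l%:Z) => _; exists N1, D1; split=> //.
rewrite e NE DE !rmorphM !rmorphXn -/pi expfzDr // -invr_expz -!exprnP.
by field; rewrite jn0 ?expf_neq0.
Qed.

(** No positive power of [pi] is in [U], as it vanishes at t, and no negative one, as [U] is closed
    under inverses. *)
Let order_uniq k l x : U (x / pi ^ k) -> U (x / pi ^ l) -> k = l.
Proof.
have U0 y : U y -> y != 0.
  by move=> [N [D [N0 D0 ->]]]; rewrite mulf_neq0 ?invr_eq0 ?jn0.
have pos n : ~ U (pi ^+ n.+1).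
  move=> [N [D [N0 D0 e]]]; case/negP: N0; apply/eqP.
  suff -> : N = ('X - t%:P) ^+ n.+1 * D.
    by rewrite hornerM horner_exp hornerXsubC subrr expr0n mul0r.
  by apply: j_inj; rewrite rmorphM rmorphXn -/pi e divfK ?jn0.
move=> Uk Ul; have x0 : x != 0 by have := U0 _ Uk; apply: contraNneq => ->; rewrite mul0r.
have : U (pi ^ (l - k)).
  have -> : pi ^ (l - k) = (x / pi ^ k) / (x / pi ^ l).
    rewrite expfzDr // -invr_expz; field.
    by rewrite x0 !expfz_neq0.
  by apply: UM => //; apply: UV.
case E : (l - k) => [[|n]|n]; first by move/eqP: E; rewrite subr_eq0 => /eqP.
  by move/pos.
by rewrite NegzE -invr_expz => /UV; rewrite invrK => /pos.
Qed.

Lemma rational_point_valuation : exists v : discrete_valuation K,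
  [/\ forall N D, D.[t] != 0 -> j N / j D \in dvr v,
      forall N D, D.[t] != 0 -> N.[t] = 0 -> j N / j D \in dvr_max v &
      forall r, r \in dvr v -> exists c, r - j c%:P \in dvr_max v].
Proof.
have [w wP] := boolp.choice order_decomp.
have wE x k : x != 0 -> U (x / pi ^ k) -> w x = k.
  by move=> x0; apply: order_uniq; apply: wP.
have wM x y : x != 0 -> y != 0 -> w (x * y) = w x + w y.
  move=> x0 y0; apply: wE; first exact: mulf_neq0.
  by rewrite expfzDr // invfM mulrACA; apply: UM; apply: wP.
have w_poly N D : N != 0 -> D.[t] != 0 -> exists n q,
    [/\ q.[t] != 0, N = q * ('X - t%:P) ^+ n & w (j N / j D) = n%:Z].
  move=> N0 D0; have [n [q]] := multiplicity_XsubC N t; rewrite N0 => /= qt e.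
  exists n, q; split=> //; apply: wE.
    by apply: mulf_neq0; [rewrite j0 | rewrite invr_eq0 jn0].
  exists q, D; split=> //; rewrite e rmorphM rmorphXn -/pi -exprnP; field.
  by rewrite expf_neq0 // jn0.
have w_ge0 x : x != 0 -> 0 <= w x -> exists N D, D.[t] != 0 /\ x = j N / j D.
  move=> x0; have [N [D [N0 D0 e]]] := wP x x0.
  case: (w x) e => // n e _; exists (N * ('X - t%:P) ^+ n), D; split=> //.
  by rewrite rmorphM rmorphXn mulrAC -e -exprnP divfK ?expf_neq0.
have w_pi k : w (pi ^ k) = k.
  apply: wE; first exact: expfz_neq0.
  exists 1, 1; rewrite !hornerC oner_neq0; split=> //.
  by rewrite rmorph1 divr1 divff // expfz_neq0.
(* Division by pi ^ m moves x and y into the local ring at t, where the sum of two fractions has a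
   denominator nonzero at t. *)
have wD x y : x != 0 -> y != 0 -> x + y != 0 -> Num.min (w x) (w y) <= w (x + y).
  move=> x0 y0 xy0; set m := Num.min _ _.
  have pm0 : pi ^ m != 0 by apply: expfz_neq0.
  have shift z : z != 0 -> w z = w (z / pi ^ m) + m.
    by move=> z0; rewrite -{2}(w_pi m) -wM ?divfK ?mulf_neq0 ?invr_eq0.
  have [||N [D [D0 e]]] := w_ge0 (x / pi ^ m); first by rewrite mulf_neq0 ?invr_eq0.
    by rewrite -(lerD2r m) -shift // add0r ge_min lexx.
  have [||N' [D' [D'0 e']]] := w_ge0 (y / pi ^ m); first by rewrite mulf_neq0 ?invr_eq0.
    by rewrite -(lerD2r m) -shift // add0r ge_min lexx orbT.
  rewrite (shift (x + y)) // -lerBlDr subrr.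
  have E : (x + y) / pi ^ m = j (N * D' + N' * D) / j (D * D').
    by rewrite mulrDl e e' rmorphD !rmorphM addf_div ?jn0.
  have [||n [q [_ _ e2]]] := w_poly (N * D' + N' * D) (D * D').
  - have : (x + y) / pi ^ m != 0 by rewrite mulf_neq0 ?invr_eq0.
    by rewrite E; apply: contraNneq => ->; rewrite rmorph0 mul0r.
  - by rewrite hornerM mulf_neq0.
  by rewrite E e2.
have w_surj k : exists2 x, x != 0 & w x = k.
  by exists (pi ^ k); rewrite ?w_pi ?expfz_neq0.
pose v := DiscreteValuation wM wD w_surj.
have vmax N D : D.[t] != 0 -> N.[t] = 0 -> j N / j D \in dvr_max v.
  move=> Dt Nt; rewrite unfold_in /dvr_max /=.
  have [->|N0] := eqVneq N 0; first by rewrite rmorph0 mul0r eqxx.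
  have [[|n] [q [qt NE ->]]] := w_poly N D N0 Dt; last by rewrite orbT.
  by move: Nt qt; rewrite NE mulr1 => ->; rewrite eqxx.
exists v; split=> //.
- move=> N D Dt; rewrite unfold_in /dvr /=.
  have [->|N0] := eqVneq N 0; first by rewrite rmorph0 mul0r eqxx.
  by have [n [q [_ _ ->]]] := w_poly N D N0 Dt; rewrite orbT.
- move=> r; rewrite unfold_in /dvr /= => rv.
  have [N [D [Dt ->]]] : exists N D, D.[t] != 0 /\ r = j N / j D.
    have [->|r0] := eqVneq r 0; last by apply: w_ge0 => //; rewrite (negPf r0) in rv.
    by exists 0, 1; rewrite hornerC oner_neq0 rmorph0 mul0r.
  (* The residue of N / D is its value at t. *)
  exists (N.[t] / D.[t]).
  have -> : j N / j D - j (N.[t] / D.[t])%:P = j (N - (N.[t] / D.[t]) *: D) / j D.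
    by rewrite rmorphB -mul_polyC [j (_ * D)]rmorphM mulrBl mulfK // jn0.
  by apply: vmax => //; rewrite hornerD hornerN hornerZ divfK ?subrr.
Qed.

End PlaceOfRationalPoint.

(** * Valuations with residue field Q and evaluation of forms *)

(** Ring morphisms from Q to a field are unique, so an isomorphism from the residue field to Q
    inverts the canonical map from Q. One exists exactly when this map, injective in any case, is
    surjective. *)
Lemma residue_field_ratP (K : fieldType) (v : discrete_valuation K) (k : {rmorphism rat -> K}) :
  (forall c, k c \in dvr v) ->
  ring_isom (residue_field v) rat <-> (forall r, r \in dvr v -> exists c, r - k c \in dvr_max v).
Proof.
move=> kv; pose h c := DvrType (kv c).
have hZ : zmod_morphism h by move=> x y; apply: val_inj; rewrite /= !rmorphB.
have hM : monoid_morphism h.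
  by split=> [|x y]; apply: val_inj; rewrite /= ?rmorph1 ?rmorphM.
pose hZi := GRing.isZmodMorphism.Build rat (dvr_type v) h hZ.
pose hMi := GRing.isMonoidMorphism.Build rat (dvr_type v) h hM.
pose H : {rmorphism rat -> dvr_type v} := HB.pack h hZi hMi.
pose f : {rmorphism rat -> residue_field v} := \pi_(residue_field v)%qT \o H.
have fE r (rv : r \in dvr v) c :
    \pi_(residue_field v)%qT (DvrType rv) = f c <-> r - k c \in dvr_max v.
  have e : (DvrType rv - H c \in @dvr_max_ideal K v) = (r - k c \in dvr_max v).
    by rewrite unfold_in /dvr_max_ideal rmorphB.
  by rewrite -e Quotient.idealrBE; split=> /eqP.
split=> [[psi psi_bij] r rv|kP].
  exists (psi (\pi_(residue_field v)%qT (DvrType rv))); apply/(fE _ rv).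
  apply: (bij_inj psi_bij).
  exact: (esym (eq_rat_rmorphism (psi \o f) idfun _)).
have f_surj y : exists c, f c = y.
  elim/quotW: y => -[r rv]; have [c rc] := kP r rv.
  by exists c; apply/esym/fE.
have [g gK] := boolp.choice f_surj.
have [|psi fK psiK] := @bijective_rmorphism_inv _ _ f.
  by exists g => // c; apply: (fmorph_inj f); rewrite gK.
by exists psi; exists f.
Qed.

Lemma meval_homogZ (R : comNzRingType) n d (g : {mpoly R[n]}) (p : 'I_n -> R) (c : R) :
  g \is d.-homog -> g.@[fun i => c * p i] = c ^+ d * g.@[p].
Proof.
move=> /dhomogP gd; rewrite !mevalE mulr_sumr; apply: eq_big_seq => m /gd dm.
rewrite mulrCA; congr (_ * _).
rewrite (_ : c ^+ d = \prod_i c ^+ m i) -?big_split; last by rewrite prodrXr -mdegE -dm.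
by apply: eq_bigr => i _ /=; rewrite exprMn.
Qed.

Lemma eval_algC_rat (p : 'I_3 -> rat) g : eval_algC (fun i => ratr (p i)) g = ratr g.@[p].
Proof.
rewrite /eval_algC /map_mpoly [meval p g]/meval /mmap !rmorph_sum; apply: eq_bigr => m _ /=.
rewrite mevalM mevalC rmorphM; congr (_ * _).
rewrite /mmap1 !rmorph_prod; apply: eq_bigr => i _ /=.
by rewrite !rmorphXn /= !mevalXU.
Qed.

Lemma dvr_max1 (K : fieldType) (v : discrete_valuation K) : 1 \notin dvr_max v.
Proof. by rewrite unfold_in /dvr_max oner_eq0 dval1 ltxx. Qed.

Lemma dvr_addr (K : fieldType) (v : discrete_valuation K) x y :
  x \in dvr v -> y \in dvr v -> x + y \in dvr v.
Proof. exact: rpredD. Qed.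

Lemma dvr_mulr (K : fieldType) (v : discrete_valuation K) x y :
  x \in dvr v -> y \in dvr v -> x * y \in dvr v.
Proof. exact: rpredM. Qed.

(** * Places above a rational point of the curve *)

Section RationalPoint.
Variables (C : plane_curve) (p : 'I_3 -> rat).
Let pC : 'I_3 -> algC := fun i => ratr (p i).
Implicit Types (j : {rmorphism {poly rat} -> function_field C}) (b : 'I_3 -> {poly rat}).
Implicit Types (v : discrete_valuation (function_field C)).

Let evalE g : eval_algC pC g = ratr g.@[p] := eval_algC_rat p g.

Let eval_neq0 g : (eval_algC pC g != 0) = (g.@[p] != 0).
Proof. by rewrite evalE fmorph_eq0. Qed.

Let meval_curve_ideal g : (map_Q C).@[p] = 0 -> g \in curve_ideal C -> g.@[p] = 0.
Proof. by move=> p0 /boolp.asboolP[h ->]; rewrite mevalM p0 mulr0. Qed.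

(** The place T = t works: a form g of degree d has g(p) = l ^ d g(b)(t), so it vanishes at p
    exactly when g(b) vanishes at t. *)
Lemma place_of_chart_value j b (t l : rat) : chart j b -> l != 0 ->
  (forall i, p i = l * (b i).[t]) ->
  exists v, lies_above v pC /\ ring_isom (residue_field v) rat.
Proof.
move=> ch l0 pE; have [j_inj j_gen _] := ch.
have [v [v1 v2 v3]] := rational_point_valuation t j_inj j_gen.
have meE d g : g \is d.-homog -> g.@[p] = l ^+ d * (poly_form b g).[t].
  move=> gd; rewrite horner_poly_form -(meval_homogZ _ _ gd).
  by apply: meval_eq.
exists v; split; last first.
  apply/(@residue_field_ratP _ v (j \o polyC)) => // c /=.
  rewrite -[j _]divr1 -(rmorph1 j); apply: v1.
  by rewrite hornerC oner_neq0.
split=> r [d [g [h [gd hd]]]]; rewrite eval_neq0 (meE d h hd) mulf_eq0 negb_or => /andP[_ ht].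
  by move=> /(chart_hfrac ch gd hd) ->; apply: v1.
rewrite evalE => /eqP; rewrite fmorph_eq0 (meE d g gd) mulf_eq0 expf_eq0 (negPf l0) andbF /=.
by move=> /eqP g0 /(chart_hfrac ch gd hd) ->; apply: v2.
Qed.

Lemma ff_val_const j c : ff_val (j c%:P) = coord_frac C c%:MP.
Proof. exact: (eq_rat_rmorphism ((val \o j) \o polyC) (coord_frac C \o (@mpolyC 3 rat))). Qed.

Lemma local_ring_const j c : local_ring pC (j c%:P).
Proof.
exists 0%N, c%:MP, 1; split; rewrite ?dhomog1 //.
  by rewrite -[c%:MP]mulr1 mul_mpolyC; apply: rpredZ; apply: dhomog1.
  by rewrite eval_neq0 rmorph1 oner_neq0.
rewrite /hfrac -/(coord_frac C _) coord_class1 tofrac1 divr1.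
exact: ff_val_const.
Qed.

(** At this place T is congruent to t, so a polynomial in T lies in the maximal ideal exactly when t
    is a root. Applied to the functions (p_i1 X_i - p_i X_i1) / X_i1, which vanish at p, this makes
    p and b(t) proportional. *)
Lemma chart_value_of_place j b v (t : rat) : chart j b ->
  (forall r, local_ring pC r -> r \in dvr v) ->
  (forall r, local_max pC r -> r \in dvr_max v) ->
  j ('X - t%:P) \in dvr_max v ->
  on_curve C pC -> (exists i, (b i).[t] != 0) ->
  exists l, forall i, p i = l * (b i).[t].
Proof.
move=> ch lr lm jt [[i1]]; rewrite fmorph_eq0 => pi1.
rewrite evalE => /eqP; rewrite fmorph_eq0 => /eqP pc [i2 bi2].
have [j_inj _ [mu mu0 muE]] := ch.
have constP c : j c%:P \in dvr v by apply/lr/local_ring_const.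
have polyP q : j q \in dvr v.
  elim/poly_ind: q => [|q c IH]; first exact: (constP 0).
  have -> : q * 'X + c%:P = q * (('X - t%:P) + t%:P) + c%:P by rewrite subrK.
  rewrite rmorphD rmorphM rmorphD; apply: dvr_addr (constP c); apply: dvr_mulr IH _.
  exact: dvr_addr (dvr_maxW jt) (constP t).
have rootP q : q.[t] = 0 -> j q \in dvr_max v.
  by move=> /eqP/factor_theorem[q1 ->]; rewrite rmorphM; exact: dvr_max_mull (polyP q1) jt.
have nrootP q : j q \in dvr_max v -> q.[t] = 0.
  move=> jq; apply/eqP; apply: contraT => qt.
  have : j (q - q.[t]%:P) \in dvr_max v.
    by apply: rootP; rewrite hornerD hornerN hornerC subrr.
  move=> /(dvr_max_subr jq); rewrite -rmorphB opprB addrCA subrr addr0.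
  move=> /(dvr_max_mull (constP q.[t]^-1)); rewrite -rmorphM -polyCM mulVf // rmorph1.
  by rewrite (negPf (dvr_max1 v)).
have X0 : 'X_i1 \notin curve_ideal C.
  by apply: contraNN pi1 => /(meval_curve_ideal pc); rewrite mevalXU => ->.
have hX i : ('X_i : {mpoly rat[3]}) \is 1.-homog.
  by rewrite dhomogX; apply/eqP; exact: mdeg1.
have rel i : p i1 * (b i).[t] = p i * (b i1).[t].
  pose g : {mpoly rat[3]} := (p i1)%:MP * 'X_i - (p i)%:MP * 'X_i1.
  have gd : g \is 1.-homog by rewrite /g !mul_mpolyC; apply: rpredB; apply: rpredZ.
  have [r rE] := function_field_elt gd (hX i1) X0.
  have rm : r \in dvr_max v.
    apply: lm; exists 1%N, g, 'X_i1; split=> //.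
      by rewrite eval_neq0 mevalXU.
    rewrite evalE /g mevalB !mevalM !mevalC !mevalXU [p i * _]mulrC subrr.
    exact: rmorph0.
  have pfX k : poly_form b 'X_k = b k by rewrite /poly_form mmapX mmap1U.
  have pfC c : poly_form b c%:MP = c%:P by rewrite /poly_form mmapC.
  have jb0 : j (b i1) != 0.
    by rewrite -ff_val_eq0 muE; apply: (mulf_neq0 mu0); rewrite coord_frac_eq0.
  have := chart_hfrac ch gd (hX i1) rE; rewrite pfX => r2.
  have : j (poly_form b g) \in dvr_max v.
    have -> : j (poly_form b g) = j (b i1) * r by rewrite r2 mulrCA (divff jb0) mulr1.
    exact: dvr_max_mull (polyP _) rm.
  move/nrootP; rewrite /g rmorphB !rmorphM /= !pfC !pfX !hornerE => /eqP.
  by rewrite subr_eq0 => /eqP.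
(* Otherwise [rel] would make every b_i(t) zero. *)
have bi1 : (b i1).[t] != 0.
  apply: contraNneq bi2 => e; have := rel i2; rewrite e mulr0 => /eqP.
  by rewrite mulf_eq0 (negPf pi1).
exists (p i1 / (b i1).[t]) => i; rewrite mulrAC rel mulfK //.
Qed.

(** Either some place above the point has residue field Q, or the point is nonsingular; then its
    local ring is the valuation ring, and residues are values at p. *)
Lemma place_of_good_point j : on_curve C pC -> ~ bad_point C pC ->
  exists v, [/\ forall r, local_ring pC r -> r \in dvr v,
    forall r, local_max pC r -> r \in dvr_max v &
    forall r, r \in dvr v -> exists c, r - j c%:P \in dvr_max v].
Proof.
move=> oc nbad; have [_] := oc; rewrite evalE => /eqP; rewrite fmorph_eq0 => /eqP pc.
have [[v [[v1 v2] iso]]|nex] :=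
  boolp.pselect (exists v, lies_above v pC /\ ring_isom (residue_field v) rat).
  exists v; split=> // r rv.
  apply: (iffLR (@residue_field_ratP _ v (j \o polyC) _)) => // c.
  by apply/v1/local_ring_const.
have : ~ singular C pC by move=> sg; apply: nbad.
move=> /boolp.contrapT[v vP].
have vmax r : local_max pC r -> r \in dvr_max v.
  move=> [d [g [h [gd hd h0 g0 rE]]]].
  have rv : r \in dvr v by apply/vP; exists d, g, h.
  (* Otherwise 1 / r = g' / h' is also regular at p, and g g' = h h' on the curve contradicts g(p) =
     0 with h(p) and h'(p) nonzero. *)
  apply: contraT; rewrite unfold_in /dvr_max negb_or => /andP[r0 vr].
  move: rv; rewrite unfold_in /dvr (negPf r0) /= => vr0.
  have vr1 : v r = 0 by apply/eqP; rewrite eq_le vr0 andbT leNgt.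
  have : r^-1 \in dvr v.
    rewrite unfold_in /dvr invr_eq0 (negPf r0) /=.
    have : v (r * r^-1) = v r + v r^-1 by rewrite dvalM ?invr_eq0.
    by rewrite divff // dval1 vr1 add0r => <-.
  move=> /vP[d' [g' [h' [g'd h'd h'0 r'E]]]].
  rewrite eval_neq0 in h0; rewrite eval_neq0 in h'0.
  have notin k : k.@[p] != 0 -> coord_frac C k != 0.
    by move=> kp; rewrite coord_frac_eq0; apply: contraNN kp => /(meval_curve_ideal pc) ->.
  have : coord_frac C (g * g' - h * h') = 0.
    rewrite rmorphB !rmorphM /=.
    have : ff_val (r * r^-1) = 1 by rewrite divff // rmorph1.
    rewrite ff_valM rE r'E /hfrac -!/(coord_frac C _) mulf_div => /divr1_eq ->.
    by rewrite subrr.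
  move=> /eqP; rewrite coord_frac_eq0 => /(meval_curve_ideal pc) /eqP.
  move/eqP: g0; rewrite evalE fmorph_eq0 => /eqP g0.
  by rewrite mevalB !mevalM g0 mul0r sub0r oppr_eq0 mulf_eq0 (negPf h0) (negPf h'0).
exists v; split=> // [r /vP //|r /vP[d [g [h [gd hd h0 rE]]]]].
rewrite eval_neq0 in h0.
(* Subtracting the value of r at p leaves a function that vanishes at p. *)
exists (g.@[p] / h.@[p]); apply: vmax.
exists d, (g - (g.@[p] / h.@[p]) *: h), h; split=> //.
- by apply: rpredB => //; apply: rpredZ.
- by rewrite eval_neq0.
- by rewrite evalE mevalB mevalZ divfK // subrr rmorph0.
have h'0 : coord_frac C h != 0.
  by rewrite coord_frac_eq0; apply: contraNN h0 => /(meval_curve_ideal pc) ->.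
rewrite ff_valB rE ff_val_const /hfrac -!/(coord_frac C _) -mul_mpolyC.
move: (_ / _)%:MP => c; by rewrite rmorphB rmorphM /= [RHS]mulrBl (mulfK h'0).
Qed.

End RationalPoint.

(** * Good integer points as rational multiples of values of the forms *)

Lemma int_zeroE (f : {mpoly int[3]}) (x : 'I_3 -> int) :
  (map_Q f).@[fun i => (x i)%:~R] = (f.@[x])%:~R.
Proof.
rewrite /map_Q /map_mpoly [meval x f]/meval /mmap !rmorph_sum; apply: eq_bigr => m _ /=.
rewrite mevalM mevalC rmorphM; congr (_ * _).
rewrite /mmap1 !rmorph_prod; apply: eq_bigr => i _ /=.
by rewrite !rmorphXn /= !mevalXU.
Qed.

Section ParametrizedCurve.
Variables (C : plane_curve) (N : nat) (q : 'I_3 -> {poly int}).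
Variables (j : {rmorphism {poly rat} -> function_field C}).
Hypotheses (sq : forall i, (size (q i) <= N.+1)%N).
Hypotheses (qU : unimodular q) (qrU : unimodular (fun i => hrev N (q i))).
Hypothesis ch : chart j (fun i => map_poly intr (q i)).
Implicit Types (x : 'I_3 -> int).

Let hrev0 i : (map_poly intr (hrev N (q i)) : {poly rat}).[0] = (hform N (q i) 1 0)%:~R.
Proof.
rewrite hrev_hform !rmorph_hform -/(horner_eval 0 _) rmorph_hform /= map_polyX.
by rewrite /horner_eval !rmorph1 hornerC hornerX.
Qed.

Lemma hform_of_good_point x : (exists i, x i != 0) -> C.@[x] = 0 ->
  ~ bad_point C (fun i => (x i)%:~R) ->
  exists (u v : int) (l : rat), coprimez u v /\
    forall i, (x i)%:~R = l * (hform N (q i) u v)%:~R.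
Proof.
move=> [i0 xi0] Cx; set p := fun _ => _; pose pQ i : rat := (x i)%:~R.
have -> : p = fun i => ratr (pQ i) by apply: boolp.funext => i; rewrite ratr_int.
move=> good.
have oc : on_curve C (fun i => ratr (pQ i)).
  split; first by exists i0; rewrite ratr_int intr_eq0.
  by rewrite eval_algC_rat int_zeroE Cx !rmorph0.
have [v [lr lm res]] := place_of_good_point j oc good.
(* If T is finite at the place, its residue t is u / v in lowest terms; otherwise 1 / T has residue
   0, and the reversed chart gives (u : v) = (1 : 0). *)
have [jX|jX] := boolP (j 'X \in dvr v).
  have [t tm] := res _ jX.
  have [|l lE] := @chart_value_of_place _ _ _ _ v t ch lr lm _ oc (unimodular_horner t qU).
    by rewrite rmorphB.
  exists (numq t), (denq t), (l / (denq t)%:~R ^+ N).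
  have d0 : (denq t)%:~R != 0 :> rat by rewrite intr_eq0 denq_neq0.
  split=> [|i]; first by rewrite coprimezE; apply: coprime_num_den.
  rewrite -[LHS]/(pQ i) lE rmorph_hform /= -(divfK d0 (numq t)%:~R) divq_num_den.
  by rewrite hform_horner // mulrA divfK // expf_neq0.
have [j' [jj ch']] := chart_inv sq ch.
have jX0 : j 'X != 0 by apply: contraNneq jX => ->; rewrite unfold_in /dvr eqxx.
have [|l lE] := @chart_value_of_place _ _ _ _ v 0 ch' lr lm _ oc (unimodular_horner 0 qrU).
  rewrite subr0; have -> : j' 'X = (j 'X)^-1 by rewrite -[RHS]mulr1 -jj mulKf.
  rewrite unfold_in /dvr_max invr_eq0 (negPf jX0) /=.
  move: jX; rewrite unfold_in /dvr (negPf jX0) /= -ltNge.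
  have : v (j 'X * (j 'X)^-1) = v (j 'X) + v (j 'X)^-1 by rewrite dvalM ?invr_eq0.
  by rewrite divff // dval1 => /esym/eqP; rewrite addrC addr_eq0 => /eqP ->; rewrite oppr_gt0.
by exists 1, 0, l; split=> // i; rewrite -hrev0 -lE.
Qed.

Lemma good_point_of_hform x (u v : int) (l : rat) : (exists i, x i != 0) ->
  (forall i, (x i)%:~R = l * (hform N (q i) u v)%:~R) ->
  C.@[x] = 0 /\ ~ bad_point C (fun i => (x i)%:~R).
Proof.
move=> [i0 xi0] xE; pose pQ i : rat := (x i)%:~R.
(* The chart is one where (u : v) is finite: the reversed one at 0 if v = 0, the given one at u / v
   otherwise. The power of u or v split off by homogeneity goes into [m]. *)
have [j' [b [t [m [ch1 bE]]]]] : exists (j' : {rmorphism {poly rat} -> function_field C}) b t m,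
    chart j' b /\ forall i, pQ i = m * (b i).[t].
  have [v0|v0] := eqVneq v 0.
    have [j' [_ ch']] := chart_inv sq ch.
    exists j', (fun i => map_poly intr (hrev N (q i))), 0, (l * u%:~R ^+ N); split=> // i.
    rewrite hrev0 /pQ xE v0 -mulrA; congr (_ * _); rewrite -rmorphXn -rmorphM.
    by rewrite -hform_scale mulr1 mulr0.
  exists j, (fun i => map_poly intr (q i)), (u%:~R / v%:~R), (l * v%:~R ^+ N); split=> // i.
  have d0 : v%:~R != 0 :> rat by rewrite intr_eq0.
  rewrite /pQ xE rmorph_hform -mulrA -hform_horner //; congr (_ * hform _ _ _ _).
  by rewrite divfK.
have m0 : m != 0.
  apply: contraNneq xi0 => m0; have := bE i0; rewrite m0 mul0r => /eqP.
  by rewrite /pQ intr_eq0.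
split.
  apply: (@intr_inj rat); rewrite -int_zeroE rmorph0.
  have -> : (fun i => (x i)%:~R) = (fun i => m * (b i).[t]) by apply: boolp.funext => i; apply: bE.
  rewrite (meval_homogZ _ _ (map_Q_homog (curve_homog C))) -horner_poly_form.
  by rewrite (chart_curve ch1) horner0 mulr0.
have -> : (fun i => (x i)%:~R : algC) = fun i => ratr (pQ i).
  by apply: boolp.funext => i; rewrite ratr_int.
by move=> [_ _]; apply; apply: place_of_chart_value ch1 m0 bE.
Qed.

End ParametrizedCurve.

(** * The parametrization of all good solutions *)

(** [N] is the largest degree: a Bezout identity excludes that all [q i] are zero, so the largest
    size is positive. *)
Lemma unimodular_degree n (q : 'I_n.+1 -> {poly int}) : unimodular q ->
  exists N i0, (forall i, size (q i) <= N.+1)%N /\ (q i0)`_N != 0.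
Proof.
move=> qU; have [i qi] := unimodular_horner 0 qU.
have [|i0 i0E] := @bigop.eq_bigmax 'I_n.+1 (fun i => size (q i)); first by rewrite card_ord.
have le k : (size (q k) <= size (q i0))%N by rewrite -i0E; apply: (leq_bigmax k).
have s0 : (0 < size (q i0))%N.
  apply: leq_trans (le i); rewrite size_poly_gt0; apply: contraNneq qi => ->.
  by rewrite rmorph0 horner0.
exists (size (q i0)).-1, i0; split=> [k|]; first by rewrite prednK.
by rewrite -lead_coefE lead_coef_eq0 -size_poly_gt0.
Qed.

Theorem theorem1 (n : nat) (f : {mpoly int[3]})
    (n_ge1 : (1 <= n)%N) (f_neq0 : f != 0)
    (f_homog : f \is n.-homog) (f_irr : irreducible_elt f)
    (rational : ring_isom (function_field (PlaneCurve n_ge1 f_homog f_irr))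
                          {fraction {poly rat}}) :
  exists (m : nat) (g1 g2 g3 : {mpoly rat[m]}),
    [/\ integer_valued g1, integer_valued g2, integer_valued g3 &
        forall x y z : int,
          (int_zero f x y z /\
           ~ bad_int_zero (PlaneCurve n_ge1 f_homog f_irr) x y z)
          <->
          exists t : 'I_m -> int,
            [/\ g1.@[fun i => (t i)%:~R] = x%:~R,
                g2.@[fun i => (t i)%:~R] = y%:~R &
                g3.@[fun i => (t i)%:~R] = z%:~R]].
Proof.
set C := PlaneCurve _ _ _ in rational *.
have [j [q [ch qU]]] := chart_exists rational.
have [N [i0 [sq qN]]] := unimodular_degree qU.
have qrU := unimodular_hrev sq qN qU.
have [R [R0 RP]] := bounded_denominator sq qN qU.
have [m [g [gZ gP]]] := parametrization N q R0.
exists m, (g 0), (g 1), (g ord_max); split=> // x y z.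
pose X : 'I_3 -> int := tnth [tuple x; y; z].
(* The zero triple is a solution because the degree is positive; it defines no projective point and
   is treated apart in both directions. *)
have fX0 : (forall i, X i = 0) -> f.@[X] = 0.
  move=> X0; rewrite (meval_eq (v2 := fun i => 0 * X i)); last by move=> i; rewrite mul0r X0.
  by rewrite (meval_homogZ _ _ f_homog) expr0n gtn_eqF ?mul0r.
split=> [[fX good]|[t [tx ty tz]]].
  have [t tE] : exists t : 'I_m -> int, forall i, (g i).@[fun k => (t k)%:~R] = (X i)%:~R.
    apply/gP; have [/forallP X0|/forallPn[i Xi]] := boolP [forall i, X i == 0].
      by exists 0, 0, 0 => i; rewrite (eqP (X0 i)) mulr0 mul0r.
    have [|u [v [l [uv lE]]]] := hform_of_good_point sq qU qrU ch (ex_intro _ i Xi) fX.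
      by move=> bad; apply: good; split.
    by have [w wE] := RP _ _ _ _ uv lE; exists u, v, w.
  by exists t; split; rewrite tE.
have /gP[u [v [w uvw]]] : exists t : 'I_m -> int, forall i,
    (g i).@[fun k => (t k)%:~R] = (X i)%:~R.
  exists t; case=> [[|[|[|//]]] lt3].
  - by rewrite -[X _]/x -tx; congr ((g _).@[_]); apply: val_inj.
  - by rewrite -[X _]/y -ty; congr ((g _).@[_]); apply: val_inj.
  - by rewrite -[X _]/z -tz; congr ((g _).@[_]); apply: val_inj.
have [/forallP X0|/forallPn[i Xi]] := boolP [forall i, X i == 0].
  split; first by apply: fX0 => i; apply/eqP.
  (* A bad point has a nonzero coordinate, so the zero triple is not bad. *)
  by move=> [_ [[[i]]]]; rewrite -/X (eqP (X0 i)) eqxx.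
have [|fX good] := @good_point_of_hform C N q j sq ch X u v (w%:~R / R%:~R) (ex_intro _ i Xi).
  by move=> k; rewrite mulrAC -intrM -uvw intrM mulrC mulKf // intr_eq0.
by split=> // -[].
Qed.
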